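(* (1) Suppose $\frac{\psi(x)}{\sqrt x}$ is increasing on $(0,1)$, $\psi_1(x):=\frac{\psi(x)}{x}$ is decreasing on $(0,1)$, and the halving property holds: (H) there exists $K>1$ such that $\psi_1(Kx)\le\frac12\psi_1(x)$ for all $x\in(0,1/K]$. Then there exist $0<c<C$ such that for all $\delta\in(0,\delta_0]$ and $(x_N,x_T)\in\mathbb C^2$ with $x_N\ne0$, $|x_T|\le|x_N|$, \[ c\,F_3\!\left(\delta,\left|\frac{x_T}{x_N}\right|\right)|x_N|\le\kappa_{G_\psi}(p_\delta;(x_N,x_T))\le C\,F_3\!\left(\delta,\left|\frac{x_T}{x_N}\right|\right)|x_N|, \] where $F_3(\delta,t):=\min\left(\frac{\sqrt{\psi^{-1}(\delta)}}{\delta},\ \frac{8t}{\sqrt{\psi_1^{-1}(\frac{1}{8t})}}\right)$. (2) Let $\psi(x)=x$. Then there exist $0<c<C$ such that for all $\delta\in(0,\delta_0]$ and all $(x_N,x_T)\in\mathbb C^2$, \[ c\max\left(\frac{|x_N|-|x_T|}{\sqrt\delta},|x_T|\right)\le\kappa_{G_\psi}(p_\delta;(x_N,x_T))\le C\max\left(\frac{|x_N|-|x_T|}{\sqrt\delta},|x_T|\right). \] (3) If $\frac{\psi(x)}{x}$ is increasing on $(0,1)$, there exists $C>0$ such that if $0<\delta<\psi(1)$ (with $\delta\le\delta_0$) and $|x_T|\le\frac{\psi^{-1}(\delta)}{8\delta}|x_N|$, then \[ \frac{1}{4\sqrt2}\frac{\sqrt{\psi^{-1}(\delta)}}{\delta}|x_N|\le\kappa_{G_\psi}(p_\delta;(x_N,x_T))\le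 C\frac{\sqrt{\psi^{-1}(\delta)}}{\delta}|x_N|. \]
   Context: $\mathbb D$ is the unit disc in $\mathbb C$. $\psi:[0,1]\to[0,\infty)$ is continuous with $\psi(0)=0$, $\psi(1)>0$, and $G_\psi:=\{z\in\mathbb D^2:\Re z_1<\psi(|z_2|)\}$. For $\delta\in(0,1)$, $p_\delta:=(-\delta,0)$. Standing assumption: $\delta\in(0,\delta_0]$ for a fixed $\delta_0<1$; all constants depend only on $\psi$ and $\delta_0$. $\psi^{-1}$ and $\psi_1^{-1}$ denote the inverse functions of $\psi$ and $\psi_1$ (assumed well defined at the arguments used). The Kobayashi–Royden metric of a domain $\Omega\subset\mathbb C^d$ is $\kappa_\Omega(z;X)=\inf\{\lambda^{-1}:\lambda>0,\ \exists\varphi:\mathbb D\to\Omega \text{ holomorphic},\ \varphi(0)=z,\ \varphi'(0)=\lambda X\}$. *)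

(* Defs.v *)
From Stdlib Require Import Reals.
From Coquelicot Require Import Coquelicot.
Open Scope R_scope.

Definition G_psi (psi : R -> R) (z : C * C) : Prop :=
  Cmod (fst z) < 1 /\ Cmod (snd z) < 1 /\ Re (fst z) < psi (Cmod (snd z)).

Definition holo_on_disc (phi : C -> C * C) : Prop :=
  forall w : C, Cmod w < 1 -> @ex_derive C_AbsRing (prod_NormedModule C_AbsRing C_NormedModule C_NormedModule) phi w.

(* Kobayashi-Royden metric:
   inf { 1/lam : lam > 0, exists phi : D -> Omega holomorphic,
         phi (RtoC 0) = z, phi'(0) = lam X }   (inf of the empty set = +oo) *)
Definition kobayashi (Omega : C * C -> Prop) (z X : C * C) : Rbar :=
  Glb_Rbar (fun m : R => exists lam : R, 0 < lam /\ m = / lam /\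
    exists phi : C -> C * C,
      holo_on_disc phi /\ (forall w : C, Cmod w < 1 -> Omega (phi w)) /\
      phi (RtoC 0) = z /\
      @is_derive C_AbsRing (prod_NormedModule C_AbsRing C_NormedModule C_NormedModule)
        phi (RtoC 0) (scal (RtoC lam) X)).

Definition p_delta (d : R) : C * C := (RtoC (- d), RtoC 0).

Definition standing (psi : R -> R) : Prop :=
  (forall x, 0 <= x <= 1 -> 0 <= psi x) /\
  (forall x, 0 <= x <= 1 ->
     filterlim psi (within (fun y => 0 <= y <= 1) (locally x)) (locally (psi x))) /\
  psi 0 = 0 /\ 0 < psi 1.

(* F_3(delta,t) = min( sqrt(psi^{-1} delta)/delta , 8t / sqrt(psi_1^{-1}(1/(8t))) );
   at t = 0 the second term is read as +oo (its limit), so F_3 = first term. *)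
Definition F3 (psiinv psi1inv : R -> R) (d t : R) : R :=
  if Req_EM_T t 0 then sqrt (psiinv d) / d
  else Rmin (sqrt (psiinv d) / d) (8 * t / sqrt (psi1inv (/ (8 * t)))).

(* Main.v *)
Require Import Defs.
From Stdlib Require Import Reals Lra Psatz.
From Coquelicot Require Import Coquelicot.
Open Scope R_scope.

(** Lower bounds.  Let (f, g) be an analytic disc through (-d, 0) in G_psi with derivative
    (mu, a) in modulus.  The second-order Schwarz lemma gives |g(z)| <= |z| (|z| + a), so
    on |z| < r the real part of f stays below psi (r (r + a)), and the Borel-Caratheodory
    inequality bounds r mu by twice the sum of this number and d; one chooses r with
    r (r + a) <= s, where s is psi^{-1}(d) or psi_1^{-1}(1/(8t)), whichever is larger.
    For psi(x) = x one evaluates f at a point of modulus sqrt d instead.  Both function-theoretic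
    inequalities come from one estimate for functions with nonnegative real part (lemma
    [chord]), which follows from Poisson's formula, itself obtained from Goursat's theorem
    in logarithmic polar coordinates.

    Upper bounds.  The discs are z |-> (-d + mu z, z (a + z / 2)), up to unimodular
    constants.  The constants are chosen so that the zero of the second component lies where
    the first one has negative real part; when Re z > 0 both terms of a + z / 2 help. *)

(** * Goursat's theorem *)

(** Complex differentiability is given only pointwise, without continuity of the derivative, hence
    the subdivision argument instead of Green's formula. In the coordinates z = e^(x + iy) circles
    about 0 become vertical segments, so rectangles are the only contours, and 0 itself recedes to x
    = -infinity. A puncture at 0 is thus allowed, which admits the integrand (F(z) - F(0)) (z +
    1/z), whose mean is F'(0). This yields the first Fourier coefficient of Re F without power
    series, and an estimate using no more than that coefficient and the mean is what replacing the
    Poisson kernel by a chord gives. In the upper bounds, the term z^2 / 2 is what psi(x) / sqrt x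
    is made for: beyond the scale s, monotonicity of this ratio makes psi(x^2 / 2) at least a
    multiple of x, matching the linear growth of the first component. The smaller values of x are
    where the two regimes differ. *)

(** The circulation of P dx + Q dy, counterclockwise around the rectangle with lower left corner (x,
    y) and sides h, k. *)
Definition circ (P Q : R -> R -> R) (x y h k : R) : R :=
  RInt (fun s => P s y) x (x + h) - RInt (fun s => P s (y + k)) x (x + h) +
  (RInt (Q (x + h)) y (y + k) - RInt (Q x) y (y + k)).

(** The shared coefficient [b] says that the y-derivative of P equals the x-derivative of Q.
    Differentiability at the single point is all that a pointwise complex derivative provides. *)
Definition closed_form_at (P Q : R -> R -> R) (x y : R) : Prop :=
  exists a b c, differentiable_pt_lim P x y a b /\ differentiable_pt_lim Q x y b c.

Lemma differentiable_pt_lim_continuous (f : R -> R -> R) (x y a b : R) :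
  differentiable_pt_lim f x y a b ->
  continuous (fun s => f s y) x /\ continuous (f x) y.
Proof.
  intros Hf.
  assert (Hc : continuity_2d_pt f x y).
  { apply differentiable_continuity_pt. exists a, b. exact Hf. }
  split; apply continuity_pt_filterlim, continuity_pt_locally; intros eps;
    destruct (Hc eps) as [d Hd]; exists d; intros z Hz;
    apply Hd; try exact Hz; rewrite Rminus_diag, Rabs_R0; apply cond_pos.
Qed.

Lemma RInt_near_const (f : R -> R) (a h c M : R) :
  0 <= h -> ex_RInt f a (a + h) ->
  (forall t, a <= t <= a + h -> Rabs (f t - c) <= M) ->
  Rabs (RInt f a (a + h) - c * h) <= M * h.
Proof.
  intros Hh Hf HM.
  replace (RInt f a (a + h) - c * h) with (RInt (fun t => f t - c) a (a + h)).
  - replace (M * h) with ((a + h - a) * M) by ring.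
    apply abs_RInt_le_const; [lra | | exact HM].
    apply (ex_RInt_minus f (fun _ => c)); [exact Hf | apply ex_RInt_const].
  - transitivity (RInt f a (a + h) - RInt (fun _ => c) a (a + h)).
    + apply (RInt_minus f (fun _ => c)); [exact Hf | apply ex_RInt_const].
    + rewrite RInt_const. unfold scal; simpl; unfold mult; simpl. ring.
Qed.

Section Goursat.

Variables P Q : R -> R -> R.

Definition closed_on (x y h k : R) : Prop :=
  forall u v, x <= u <= x + h -> y <= v <= y + k -> closed_form_at P Q u v.

Lemma closed_on_ex_RInt (x y h k : R) : 0 <= h -> 0 <= k -> closed_on x y h k ->
  (forall v a b, y <= v <= y + k -> x <= a -> a <= b -> b <= x + h ->
     ex_RInt (fun s => P s v) a b) /\
  (forall u a b, x <= u <= x + h -> y <= a -> a <= b -> b <= y + k ->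
     ex_RInt (Q u) a b).
Proof.
  intros Hh Hk H. split; intros w a b Hw Ha Hab Hb;
    apply (ex_RInt_continuous (V := R_CompleteNormedModule));
    rewrite Rmin_left, Rmax_right by lra; intros z Hz.
  - destruct (H z w) as (p & q & r & HP & HQ); [lra | lra |].
    apply (differentiable_pt_lim_continuous _ _ _ _ _ HP).
  - destruct (H w z) as (p & q & r & HP & HQ); [lra | lra |].
    apply (differentiable_pt_lim_continuous _ _ _ _ _ HQ).
Qed.

(** The four inner edges are each traversed twice, in opposite directions. *)
Lemma circ_quarter (x y h k : R) : 0 <= h -> 0 <= k -> closed_on x y h k ->
  circ P Q x y h k =
    circ P Q x y (h / 2) (k / 2) + circ P Q (x + h / 2) y (h / 2) (k / 2) +
    (circ P Q x (y + k / 2) (h / 2) (k / 2) +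
     circ P Q (x + h / 2) (y + k / 2) (h / 2) (k / 2)).
Proof.
  intros Hh Hk H.
  destruct (closed_on_ex_RInt x y h k Hh Hk H) as [HP HQ].
  unfold circ.
  replace (x + h / 2 + h / 2) with (x + h) by field.
  replace (y + k / 2 + k / 2) with (y + k) by field.
  assert (EP : forall v, y <= v <= y + k -> RInt (fun s => P s v) x (x + h) =
     RInt (fun s => P s v) x (x + h / 2) + RInt (fun s => P s v) (x + h / 2) (x + h)).
  { intros v Hv. symmetry. apply (RInt_Chasles (fun s => P s v)); apply HP; lra. }
  assert (EQ : forall u, x <= u <= x + h -> RInt (Q u) y (y + k) =
     RInt (Q u) y (y + k / 2) + RInt (Q u) (y + k / 2) (y + k)).
  { intros u Hu. symmetry. apply (RInt_Chasles (Q u)); apply HQ; lra. }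
  rewrite (EP y), (EP (y + k)), (EQ x), (EQ (x + h)) by lra. ring.
Qed.

(* The affine parts of P and Q at (x0,y0) contribute nothing to the circulation,
   because the two mixed coefficients agree. *)
Lemma circ_small (x y h k x0 y0 eps : R) :
  0 <= h -> 0 <= k -> closed_on x y h k ->
  (exists a b c, forall u v, x <= u <= x + h -> y <= v <= y + k ->
     Rabs (P u v - P x0 y0 - (a * (u - x0) + b * (v - y0))) <= eps * (h + k) /\
     Rabs (Q u v - Q x0 y0 - (b * (u - x0) + c * (v - y0))) <= eps * (h + k)) ->
  Rabs (circ P Q x y h k) <= 2 * eps * (h + k) ^ 2.
Proof.
  intros Hh Hk H (a & b & c & He).
  destruct (closed_on_ex_RInt x y h k Hh Hk H) as [HP HQ].
  assert (E1 : Rabs (RInt (fun s => P s y - P s (y + k)) x (x + h) - - b * k * h)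
               <= 2 * eps * (h + k) * h).
  { apply RInt_near_const; [lra | |].
    - apply (ex_RInt_minus (fun s => P s y) (fun s => P s (y + k))); apply HP; lra.
    - intros s Hs.
      destruct (He s y) as [A _]; [lra | lra |].
      destruct (He s (y + k)) as [B _]; [lra | lra |].
      apply Rabs_le_between in A. apply Rabs_le_between in B.
      apply Rabs_le_between. nra. }
  assert (E2 : Rabs (RInt (fun t => Q (x + h) t - Q x t) y (y + k) - b * h * k)
               <= 2 * eps * (h + k) * k).
  { apply RInt_near_const; [lra | |].
    - apply (ex_RInt_minus (Q (x + h)) (Q x)); apply HQ; lra.
    - intros t Ht.
      destruct (He (x + h) t) as [_ A]; [lra | lra |].
      destruct (He x t) as [_ B]; [lra | lra |].
      apply Rabs_le_between in A. apply Rabs_le_between in B.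
      apply Rabs_le_between. nra. }
  replace (circ P Q x y h k) with
    (RInt (fun s => P s y - P s (y + k)) x (x + h) +
     RInt (fun t => Q (x + h) t - Q x t) y (y + k)).
  - apply Rabs_le_between in E1. apply Rabs_le_between in E2.
    apply Rabs_le_between. nra.
  - unfold circ. f_equal.
    + apply (RInt_minus (fun s => P s y) (fun s => P s (y + k))); apply HP; lra.
    + apply (RInt_minus (Q (x + h)) (Q x)); apply HQ; lra.
Qed.

(** Moves to a quarter whose circulation exceeds the rescaled threshold. The fourth quarter is the
    untested default: if the other three are good, the triangle inequality makes it bad. *)
Definition bad_step (e h k : R) (p : R * R) : R * R :=
  let B q := Rlt_dec (e * (h / 2 + k / 2) ^ 2) (Rabs (circ P Q (fst q) (snd q) (h / 2) (k / 2))) in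
  if B p then p
  else if B (fst p + h / 2, snd p) then (fst p + h / 2, snd p)
  else if B (fst p, snd p + k / 2) then (fst p, snd p + k / 2)
  else (fst p + h / 2, snd p + k / 2).

Lemma bad_step_spec (e h k : R) (p : R * R) :
  0 <= h -> 0 <= k -> closed_on (fst p) (snd p) h k ->
  e * (h + k) ^ 2 < Rabs (circ P Q (fst p) (snd p) h k) ->
  let q := bad_step e h k p in
  e * (h / 2 + k / 2) ^ 2 < Rabs (circ P Q (fst q) (snd q) (h / 2) (k / 2)) /\
  fst p <= fst q <= fst p + h / 2 /\ snd p <= snd q <= snd p + k / 2.
Proof.
  intros Hh Hk H Hb. unfold bad_step.
  cbv zeta.
  destruct (Rlt_dec _ _) as [Hc | Hc]; [split; [exact Hc | lra] |].
  destruct (Rlt_dec _ _) as [Hc0 | Hc0]; [split; [exact Hc0 | cbn [fst snd]; lra] |].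
  destruct (Rlt_dec _ _) as [Hc1 | Hc1]; [split; [exact Hc1 | cbn [fst snd]; lra] |].
  cbn [fst snd] in *. split; [| lra].
  rewrite (circ_quarter _ _ _ _ Hh Hk H) in Hb.
  apply Rnot_lt_le in Hc. apply Rnot_lt_le in Hc0. apply Rnot_lt_le in Hc1.
  match type of Hb with _ < Rabs (?A + ?B + (?C + ?D)) =>
    pose proof (Rabs_triang (A + B) (C + D)); pose proof (Rabs_triang A B);
    pose proof (Rabs_triang C D) end.
  replace ((h + k) ^ 2) with (4 * (h / 2 + k / 2) ^ 2) in Hb by field. lra.
Qed.

Fixpoint bad_seq (e x y h k : R) (n : nat) : R * R :=
  match n with
  | O => (x, y)
  | S m => bad_step e (h / 2 ^ m) (k / 2 ^ m) (bad_seq e x y h k m)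
  end.

Lemma goursat (x y h k : R) :
  0 <= h -> 0 <= k -> closed_on x y h k -> circ P Q x y h k = 0.
Proof.
  intros Hh Hk H.
  destruct (Req_dec (circ P Q x y h k) 0) as [E | E]; [exact E | exfalso].
  apply Rabs_pos_lt in E.
  (* The added 1 avoids division by zero for a degenerate rectangle, and the factor 2 makes the
     initial inequality strict. *)
  set (e := Rabs (circ P Q x y h k) / (2 * ((h + k) ^ 2 + 1))).
  assert (Hd : 0 < (h + k) ^ 2 + 1) by nra.
  assert (He : 0 < e) by (unfold e; apply Rdiv_lt_0_compat; lra).
  assert (Hlarge : e * (h + k) ^ 2 < Rabs (circ P Q x y h k)).
  { replace (Rabs (circ P Q x y h k)) with (e * (2 * ((h + k) ^ 2 + 1)))
      by (unfold e; field; lra). nra. }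
  clearbody e.
  set (s := bad_seq e x y h k).
  assert (H2 : forall n, 0 < 2 ^ n) by (intros n; apply pow_lt; lra).
  assert (Hn : forall a n, 0 <= a -> 0 <= a / 2 ^ n).
  { intros a n Ha. apply Rle_div_r; [apply H2 | rewrite Rmult_0_l; exact Ha]. }
  assert (Hhalf : forall a n, a / 2 ^ S n = a / 2 ^ n / 2).
  { intros a n. simpl. field. apply Rgt_not_eq, H2. }
  assert (Hs : forall n,
     (x <= fst (s n) /\ fst (s n) + h / 2 ^ n <= x + h) /\
     (y <= snd (s n) /\ snd (s n) + k / 2 ^ n <= y + k) /\
     e * (h / 2 ^ n + k / 2 ^ n) ^ 2 <
       Rabs (circ P Q (fst (s n)) (snd (s n)) (h / 2 ^ n) (k / 2 ^ n)) /\
     (fst (s n) <= fst (s (S n)) <= fst (s n) + h / 2 ^ n / 2 /\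
      snd (s n) <= snd (s (S n)) <= snd (s n) + k / 2 ^ n / 2)).
  { intros n. induction n as [| n IH].
    - assert (Z : forall a, a / 2 ^ 0 = a) by (intros; simpl; field).
      change (s 1%nat) with (bad_step e (h / 2 ^ 0) (k / 2 ^ 0) (x, y)).
      change (s O) with (x, y). rewrite !Z. cbn [fst snd].
      split; [lra | split; [lra | split; [exact Hlarge |]]].
      apply (bad_step_spec e h k (x, y)); cbn [fst snd]; assumption.
    - destruct IH as (I1 & I2 & I3 & I4). rewrite !Hhalf.
      pose proof (Hn h n Hh). pose proof (Hn k n Hk).
      assert (Hin : closed_on (fst (s n)) (snd (s n)) (h / 2 ^ n) (k / 2 ^ n)).
      { intros u v Hu Hv. apply H; lra. }
      pose proof (bad_step_spec e _ _ (s n) (Hn h n Hh) (Hn k n Hk) Hin I3) as HB.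
      change (bad_step e (h / 2 ^ n) (k / 2 ^ n) (s n)) with (s (S n)) in HB.
      cbv zeta in HB.
      split; [lra | split; [lra | split; [apply HB |]]].
      rewrite <- (Hhalf h n), <- (Hhalf k n) in *.
      change (s (S (S n))) with (bad_step e (h / 2 ^ S n) (k / 2 ^ S n) (s (S n))).
      assert (Hin' : closed_on (fst (s (S n))) (snd (s (S n))) (h / 2 ^ S n) (k / 2 ^ S n)).
      { rewrite !Hhalf in *. intros u v Hu Hv. apply H; lra. }
      apply (bad_step_spec e _ _ (s (S n)) (Hn h (S n) Hh) (Hn k (S n) Hk) Hin'), HB. }
  (* Nested intervals for one coordinate: the lower ends increase, and a step of at most half the
     side keeps the upper ends decreasing. *)
  assert (Hconv : forall g : R * R -> R, forall z l,
     0 <= l ->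
     (forall n, z <= g (s n) /\ g (s n) + l / 2 ^ n <= z + l) ->
     (forall n, g (s n) <= g (s (S n)) <= g (s n) + l / 2 ^ n / 2) ->
     exists a, forall n, g (s n) <= a <= g (s n) + l / 2 ^ n).
  { intros g z l Hl A B.
    destruct (ex_finite_lim_seq_incr (fun n => g (s n)) (z + l)) as [a Ha].
    - intros n. apply B.
    - intros n. pose proof (A n). pose proof (Hn l n Hl). lra.
    - exists a. intros n. split.
      + apply (is_lim_seq_incr_compare (fun n => g (s n))); [exact Ha | apply B].
      + assert (C : forall m, g (s (n + m)%nat) + l / 2 ^ (n + m) <= g (s n) + l / 2 ^ n).
        { induction m as [| m IH].
          - rewrite Nat.add_0_r. lra.
          - rewrite <- plus_n_Sm, Hhalf. pose proof (B (n + m)%nat). lra. }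
        apply (is_lim_seq_le (fun m => g (s (m + n)%nat)) (fun _ => g (s n) + l / 2 ^ n) a (g (s n) + l / 2 ^ n)).
        * intros m. pose proof (C m). pose proof (Hn l (n + m)%nat Hl).
          rewrite Nat.add_comm. lra.
        * apply (is_lim_seq_incr_n (fun n => g (s n)) n). exact Ha.
        * apply is_lim_seq_const. }
  destruct (Hconv fst x h Hh) as [x0 Hx0]; [apply Hs | apply Hs |].
  destruct (Hconv snd y k Hk) as [y0 Hy0]; [apply Hs | apply Hs |].
  destruct (H x0 y0) as (a & b & c & HP & HQ).
  { pose proof (Hx0 O). pose proof (Hs O). simpl in *. lra. }
  { pose proof (Hy0 O). pose proof (Hs O). simpl in *. lra. }
  assert (He2 : 0 < e / 2) by lra.
  destruct (HP (mkposreal _ He2)) as [d1 Hd1].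
  destruct (HQ (mkposreal _ He2)) as [d2 Hd2]. simpl in Hd1, Hd2.
  assert (exists n, h / 2 ^ n + k / 2 ^ n < Rmin d1 d2) as [n Hsmall].
  { destruct (pow_lt_1_zero (/ 2) ltac:(rewrite Rabs_pos_eq; lra) (Rmin d1 d2 / (h + k + 1)))
      as [N HN].
    - apply Rdiv_lt_0_compat; [apply Rmin_glb_lt; apply cond_pos | lra].
    - exists N. specialize (HN N (Nat.le_refl _)).
      rewrite pow_inv, Rabs_pos_eq in HN by (left; apply Rinv_0_lt_compat, H2).
      apply Rlt_div_r in HN; [| lra].
      pose proof (Rinv_0_lt_compat _ (H2 N)). unfold Rdiv. nra. }
  pose proof (Hs n) as (I1 & I2 & I3 & _).
  pose proof (Hn h n Hh). pose proof (Hn k n Hk).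
  pose proof (Rmin_l d1 d2). pose proof (Rmin_r d1 d2).
  apply (Rlt_not_le _ _ I3).
  (* The affine approximation was requested with error e / 2 because [circ_small] doubles it. *)
  replace e with (2 * (e / 2)) by field.
  apply circ_small with x0 y0; [assumption | assumption | |].
  - intros u v Hu Hv. apply H; lra.
  - exists a, b, c. intros u v Hu Hv.
    pose proof (Hx0 n). pose proof (Hy0 n).
    assert (Bu : Rabs (u - x0) <= h / 2 ^ n + k / 2 ^ n) by (apply Rabs_le_between; lra).
    assert (Bv : Rabs (v - y0) <= h / 2 ^ n + k / 2 ^ n) by (apply Rabs_le_between; lra).
    split.
    + eapply Rle_trans; [apply Hd1; lra |].
      apply Rmult_le_compat_l; [lra | apply Rmax_lub; assumption].
    + eapply Rle_trans; [apply Hd2; lra |].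
      apply Rmult_le_compat_l; [lra | apply Rmax_lub; assumption].
Qed.

End Goursat.

(** * Complex derivatives and the mean value property *)

Definition cderiv (f : C -> C) (z l : C) : Prop :=
  @is_derive C_AbsRing (AbsRing_NormedModule C_AbsRing) f z l.

Lemma cderiv_eps (f : C -> C) (z l : C) :
  cderiv f z l <->
  forall eps, 0 < eps -> exists del, 0 < del /\ forall w, Cmod (w - z) < del ->
    Cmod (f w - f z - (w - z) * l) <= eps * Cmod (w - z).
Proof.
  split.
  - intros [_ H] eps Heps.
    destruct (H z (fun P HP => HP) (mkposreal eps Heps)) as [d Hd].
    exists d. split; [apply cond_pos |]. intros w Hw. exact (Hd w Hw).
  - intros H. split; [apply is_linear_scal_l |].
    intros x Hx. apply (@is_filter_lim_locally_unique _ (AbsRing_NormedModule C_AbsRing)) in Hx. subst x.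
    intros eps. destruct (H eps (cond_pos eps)) as (d & Hd & Hw).
    exists (mkposreal d Hd). intros w B. exact (Hw w B).
Qed.

Lemma cderiv_const (a z : C) : cderiv (fun _ => a) z 0.
Proof. exact (@is_derive_const C_AbsRing (AbsRing_NormedModule C_AbsRing) _ _). Qed.

Lemma cderiv_id (z : C) : cderiv (fun w => w) z 1.
Proof. exact (is_derive_id _). Qed.

Lemma cderiv_plus (f g : C -> C) (z a b : C) :
  cderiv f z a -> cderiv g z b -> cderiv (fun w => f w + g w)%C z (a + b).
Proof. exact (@is_derive_plus C_AbsRing (AbsRing_NormedModule C_AbsRing) f g z a b). Qed.

Lemma cderiv_minus (f g : C -> C) (z a b : C) :
  cderiv f z a -> cderiv g z b -> cderiv (fun w => f w - g w)%C z (a - b).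
Proof. exact (@is_derive_minus C_AbsRing (AbsRing_NormedModule C_AbsRing) f g z a b). Qed.

Lemma cderiv_mult (f g : C -> C) (z a b : C) :
  cderiv f z a -> cderiv g z b ->
  cderiv (fun w => f w * g w)%C z (a * g z + f z * b).
Proof. intros Hf Hg. exact (is_derive_mult f g z a b Hf Hg Cmult_comm). Qed.

Lemma cderiv_comp (f g : C -> C) (z a b : C) :
  cderiv f (g z) a -> cderiv g z b -> cderiv (fun w => f (g w)) z (b * a).
Proof. exact (@is_derive_comp C_AbsRing (AbsRing_NormedModule C_AbsRing) f g z a b). Qed.

Lemma cderiv_inv (z : C) : z <> 0 -> cderiv Cinv z (- / (z * z)).
Proof.
  intros Hz. apply cderiv_eps. intros eps Heps.
  assert (Hm : 0 < Cmod z) by (apply Cmod_gt_0, Hz).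
  set (m := Cmod z) in *.
  exists (Rmin (m / 2) (eps * (m * m * m) / 2)). split.
  { apply Rmin_glb_lt; [lra |]. apply Rdiv_lt_0_compat; [| lra].
    repeat apply Rmult_lt_0_compat; assumption. }
  intros w Hw.
  assert (H1 : Cmod (w - z) < m / 2) by (eapply Rlt_le_trans; [exact Hw | apply Rmin_l]).
  assert (H2 : Cmod (w - z) < eps * (m * m * m) / 2)
    by (eapply Rlt_le_trans; [exact Hw | apply Rmin_r]).
  assert (Hwm : m / 2 < Cmod w).
  { pose proof (Cmod_triangle w (- (w - z))) as T. rewrite Cmod_opp in T.
    replace (w + - (w - z))%C with z in T by ring. fold m in T. lra. }
  assert (Hw0 : w <> 0) by (apply Cmod_gt_0; lra).
  replace (/ w - / z - (w - z) * - / (z * z))%C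
    with ((w - z) * ((w - z) * / (w * (z * z))))%C by (field; split; assumption).
  rewrite Cmod_mult, (Rmult_comm eps). apply Rmult_le_compat_l; [apply Cmod_ge_0 |].
  rewrite Cmod_mult, Cmod_inv by (repeat apply Cmult_neq_0; assumption).
  rewrite !Cmod_mult. fold m.
  assert (Hmm : 0 < m * m) by nra.
  assert (Hd : 0 < Cmod w * (m * m)) by (apply Rmult_lt_0_compat; lra).
  apply Rle_div_l; [exact Hd |].
  left. eapply Rlt_le_trans; [exact H2 |].
  replace (eps * (m * m * m) / 2) with (eps * (m / 2 * (m * m))) by field.
  apply Rmult_le_compat_l; [lra |]. apply Rmult_le_compat_r; lra.
Qed.

Lemma cderiv_continuous (f : C -> C) (z l : C) : cderiv f z l ->
  forall eps, 0 < eps -> exists del, 0 < del /\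
    forall w, Cmod (w - z) < del -> Cmod (f w - f z) <= eps.
Proof.
  intros Hf eps Heps.
  destruct (proj1 (cderiv_eps f z l) Hf 1 Rlt_0_1) as (d & Hd & Hw).
  pose proof (Cmod_ge_0 l).
  exists (Rmin d (eps / (1 + Cmod l))). split.
  { apply Rmin_glb_lt; [exact Hd | apply Rdiv_lt_0_compat; lra]. }
  intros w B.
  assert (B1 : Cmod (w - z) < d) by (eapply Rlt_le_trans; [exact B | apply Rmin_l]).
  assert (B2 : Cmod (w - z) < eps / (1 + Cmod l))
    by (eapply Rlt_le_trans; [exact B | apply Rmin_r]).
  apply Rlt_div_r in B2; [| lra].
  pose proof (Hw w B1) as A.
  pose proof (Cmod_triangle (f w - f z - (w - z) * l) ((w - z) * l)) as T.
  replace (f w - f z - (w - z) * l + (w - z) * l)%C with (f w - f z)%C in T by ring.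
  rewrite Cmod_mult in T. lra.
Qed.

(** The Cauchy-Riemann equations. The factor sqrt 2 in the proof compares the Euclidean modulus with
    the maximum norm. *)
Lemma cderiv_differentiable (f : C -> C) (x y : R) (l : C) : cderiv f (x, y) l ->
  differentiable_pt_lim (fun u v => Re (f (u, v))) x y (Re l) (- Im l) /\
  differentiable_pt_lim (fun u v => Im (f (u, v))) x y (Im l) (Re l).
Proof.
  intros Hf.
  assert (E : forall eps : posreal, locally_2d (fun u v =>
    Cmod (f (u, v) - f (x, y) - ((u, v) - (x, y)) * l) <=
      eps * Rmax (Rabs (u - x)) (Rabs (v - y))) x y).
  { intros eps. pose proof (sqrt_lt_R0 2 ltac:(lra)) as H2.
    destruct (proj1 (cderiv_eps _ _ _) Hf (eps / sqrt 2)) as (d & Hd & Hw).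
    { apply Rdiv_lt_0_compat; [apply cond_pos | exact H2]. }
    exists (mkposreal _ (Rdiv_lt_0_compat _ _ Hd H2)). simpl. intros u v Hu Hv.
    pose proof (Cmod_2Rmax ((u, v) - (x, y))) as T. simpl in T.
    fold (u - x) in T. fold (v - y) in T.
    eapply Rle_trans; [apply Hw |].
    - eapply Rle_lt_trans; [exact T |].
      rewrite Rmult_comm. apply Rlt_div_r; [lra | apply Rmax_lub_lt; assumption].
    - replace (eps * Rmax (Rabs (u - x)) (Rabs (v - y)))
        with (eps / sqrt 2 * (sqrt 2 * Rmax (Rabs (u - x)) (Rabs (v - y)))) by (field; lra).
      apply Rmult_le_compat_l; [| exact T].
      left. apply Rdiv_lt_0_compat; [apply cond_pos | exact H2]. }
  split; intros eps; destruct (E eps) as [d Hd]; exists d; intros u v Hu Hv;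
    (eapply Rle_trans; [| apply (Hd u v Hu Hv)]);
    (eapply Rle_trans; [| apply Rmax_Cmod]).
  - eapply Rle_trans; [| apply Rmax_l]. apply Req_le. f_equal.
    unfold Re, Im. simpl. ring.
  - eapply Rle_trans; [| apply Rmax_r]. apply Req_le. f_equal.
    unfold Re, Im. simpl. ring.
Qed.

Lemma differentiable_pt_lim_mult_sep (f g : R -> R) (x y a b : R) :
  derivable_pt_lim f x a -> derivable_pt_lim g y b ->
  differentiable_pt_lim (fun u v => f u * g v) x y (a * g y) (f x * b).
Proof.
  intros Hf Hg.
  assert (Hm : differentiable_pt_lim Rmult (f x) (g y) (g y) (f x)).
  { intros eps. exists eps. intros u v Hu Hv.
    replace (u * v - f x * g y - (g y * (u - f x) + f x * (v - g y)))
      with ((u - f x) * (v - g y)) by ring.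
    rewrite Rabs_mult. apply Rmult_le_compat; try apply Rabs_pos; [lra | apply Rmax_r]. }
  assert (Hg' : differentiable_pt_lim (fun _ v => g v) x y 0 b).
  { intros eps. destruct (differentiable_pt_lim_proj1_0 g y x b Hg eps) as [d Hd].
    exists d. intros u v Hu Hv. specialize (Hd v u Hv Hu).
    rewrite Rmax_comm. eapply Rle_trans; [| exact Hd]. apply Req_le. f_equal. ring. }
  pose proof (differentiable_pt_lim_comp Rmult (fun u _ => f u) (fun _ v => g v) x y
    _ _ _ _ _ _ Hm (differentiable_pt_lim_proj1_0 f x y a Hf) Hg') as H.
  replace (a * g y) with (g y * a + f x * 0) by ring.
  replace (f x * b) with (g y * 0 + f x * b) by ring. exact H.
Qed.

Definition cis (t : R) : C := (cos t, sin t).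

Lemma Cmod_cis (t : R) : Cmod (cis t) = 1.
Proof.
  unfold Cmod, cis. cbn [fst snd]. rewrite <- sqrt_1. f_equal.
  pose proof (sin2_cos2 t) as H. unfold Rsqr in H. lra.
Qed.

(** With z = e^(x + iy), the imaginary part of U d(x + iy) is the closed form Im U dx + Re U dy. On
    the rectangle [-h, 0] x [0, 2 pi] the right side carries the wanted integral, and the left side
    tends to 2 pi Re l as h grows. *)
Lemma circle_mean (U : C -> C) (l : C) :
  (forall z, 0 < Cmod z <= 1 -> exists d, cderiv U z d) ->
  (forall eps, 0 < eps -> exists del, 0 < del /\
     forall z, 0 < Cmod z < del -> Cmod (U z - l) <= eps) ->
  ex_RInt (fun t => Re (U (cis t))) 0 (2 * PI) /\
  RInt (fun t => Re (U (cis t))) 0 (2 * PI) = 2 * PI * Re l.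
Proof.
  intros HU Hl.
  set (P := fun x y => Im (U (exp x * cos y, exp x * sin y))).
  set (Q := fun x y => Re (U (exp x * cos y, exp x * sin y))).
  assert (Hpi := PI_RGT_0).
  assert (Hpolar : forall x y, ((exp x * cos y, exp x * sin y) : C) = (RtoC (exp x) * cis y)%C).
  { intros x y. unfold cis, RtoC, Cmult. simpl. f_equal; ring. }
  assert (Hmod : forall x y, Cmod (exp x * cos y, exp x * sin y) = exp x).
  { intros x y. rewrite Hpolar, Cmod_mult, Cmod_cis, Cmod_R, Rabs_pos_eq;
      [ring | left; apply exp_pos]. }
  assert (Hcl : forall h, closed_on P Q (- h) 0 h (2 * PI)).
  { intros h x y Hx Hy.
    destruct (HU (exp x * cos y, exp x * sin y)) as [d Hd].
    { rewrite Hmod. split; [apply exp_pos |]. rewrite <- exp_0.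
      destruct (Req_dec x 0) as [-> | Hx0]; [lra | left; apply exp_increasing; lra]. }
    destruct (cderiv_differentiable _ _ _ _ Hd) as [DR DI].
    pose proof (differentiable_pt_lim_mult_sep _ _ x y _ _
      (derivable_pt_lim_exp x) (derivable_pt_lim_cos y)) as Dc.
    pose proof (differentiable_pt_lim_mult_sep _ _ x y _ _
      (derivable_pt_lim_exp x) (derivable_pt_lim_sin y)) as Ds.
    pose proof (differentiable_pt_lim_comp _ _ _ _ _ _ _ _ _ _ _ DI Dc Ds) as D1.
    pose proof (differentiable_pt_lim_comp _ _ _ _ _ _ _ _ _ _ _ DR Dc Ds) as D2.
    eexists. eexists. eexists. split; [exact D1 |].
    match type of D2 with differentiable_pt_lim _ _ _ ?A ?B =>
      match goal with |- differentiable_pt_lim _ _ _ ?A' _ =>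
        replace A' with A by ring end end.
    exact D2. }
  assert (HQ0 : forall t, Q (- 0 + 0) t = Re (U (cis t))).
  { intros t. unfold Q, cis. rewrite Ropp_0, Rplus_0_r, exp_0, !Rmult_1_l. reflexivity. }
  assert (HI : forall h t, 0 <= h -> Q (- h + h) t = Re (U (cis t))).
  { intros h t _. rewrite <- HQ0. f_equal. ring. }
  assert (Hex : ex_RInt (fun t => Re (U (cis t))) 0 (2 * PI)).
  (* The degenerate strip h = 0 already gives integrability on the unit circle. *)
  { destruct (closed_on_ex_RInt P Q (- 0) 0 0 (2 * PI)) as [_ H]; [lra | lra | apply Hcl |].
    apply ex_RInt_ext with (Q (- 0 + 0)); [intros t _; apply HQ0 |].
    apply H; lra. }
  split; [exact Hex |].
  apply cond_eq. intros eps Heps.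
  assert (He2 : 0 < eps / (4 * PI)) by (apply Rdiv_lt_0_compat; lra).
  destruct (Hl _ He2) as (del & Hdel & Hz).
  set (h := Rabs (ln (del / 2)) + 1).
  assert (Hh : 0 <= h) by (unfold h; pose proof (Rabs_pos (ln (del / 2))); lra).
  assert (Hexp : exp (- h) < del).
  { apply Rlt_trans with (del / 2); [| lra].
    rewrite <- (exp_ln (del / 2)) by lra. apply exp_increasing. unfold h.
    pose proof (Rabs_maj2 (ln (del / 2))). lra. }
  pose proof (goursat P Q (- h) 0 h (2 * PI) Hh ltac:(lra) (Hcl h)) as G.
  unfold circ in G.
  (* The two horizontal sides cancel by 2 pi periodicity. *)
  rewrite (RInt_ext (fun s => P s 0) (fun s => P s (0 + 2 * PI))) in G.
  2:{ intros s _. unfold P. rewrite cos_plus, sin_plus, cos_2PI, sin_2PI, cos_0, sin_0.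
      do 3 f_equal; ring. }
  rewrite (RInt_ext (Q (- h + h)) (fun t => Re (U (cis t)))) in G.
  2:{ intros t _. apply HI, Hh. }
  rewrite Rplus_0_l in G.
  assert (B : Rabs (RInt (Q (- h)) 0 (0 + 2 * PI) - Re l * (2 * PI)) <= eps / (4 * PI) * (2 * PI)).
  { apply RInt_near_const; [lra | |].
    - destruct (closed_on_ex_RInt P Q (- h) 0 h (2 * PI)) as [_ H]; [lra | lra | apply Hcl |].
      apply H; lra.
    - intros t _. unfold Q.
      eapply Rle_trans; [| apply (Hz (exp (- h) * cos t, exp (- h) * sin t))].
      + exact (re_le_Cmod (U (exp (- h) * cos t, exp (- h) * sin t) - l)).
      + rewrite Hmod. split; [apply exp_pos | exact Hexp]. }
  rewrite Rplus_0_l in B.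
  replace (eps / (4 * PI) * (2 * PI)) with (eps / 2) in B by (field; lra).
  replace (RInt (fun t => Re (U (cis t))) 0 (2 * PI)) with (RInt (Q (- h)) 0 (2 * PI)) by lra.
  replace (2 * PI * Re l) with (Re l * (2 * PI)) by ring. lra.
Qed.

(** * Poisson's formula *)

Lemma cis_inv (t : R) : (/ cis t)%C = (cos t, - sin t).
Proof.
  unfold cis, Cinv. cbn [fst snd].
  pose proof (sin2_cos2 t) as H. unfold Rsqr in H.
  replace (cos t ^ 2 + sin t ^ 2) with 1 by lra.
  f_equal; field.
Qed.

Lemma Cmod_neq_0 (z : C) : 0 < Cmod z -> z <> 0.
Proof. intros H. apply Cmod_gt_0, H. Qed.

Ltac eqR := match goal with |- ?a = ?b => change (@eq R a b) end.

Lemma ex_derive_continuousR (f : R -> R) (t : R) : ex_derive f t -> continuous f t.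
Proof. exact (ex_derive_continuous (K := R_AbsRing) (V := R_NormedModule) f t). Qed.

Lemma continuous_ex_RIntR (f : R -> R) (a b : R) :
  (forall t, continuous f t) -> ex_RInt f a b.
Proof.
  intros H. apply (ex_RInt_continuous (V := R_CompleteNormedModule)). intros t _. apply H.
Qed.

Lemma RInt_cos_period : RInt cos 0 (2 * PI) = 0.
Proof.
  destruct (circle_mean (fun z => z) 0) as [_ H].
  - intros z _. exists 1. apply cderiv_id.
  - intros eps He. exists eps. split; [exact He |]. intros z Hz.
    replace (z - 0)%C with z by ring. lra.
  - simpl in H. rewrite Rmult_0_r in H. exact H.
Qed.

Lemma mean_value (F : C -> C) :
  (forall z, Cmod z <= 1 -> exists d, cderiv F z d) ->
  ex_RInt (fun t => Re (F (cis t))) 0 (2 * PI) /\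
  RInt (fun t => Re (F (cis t))) 0 (2 * PI) = 2 * PI * Re (F 0).
Proof.
  intros HF. apply circle_mean.
  - intros z Hz. apply HF. lra.
  - intros eps He. destruct (HF 0) as [d Hd]; [rewrite Cmod_0; lra |].
    destruct (cderiv_continuous F 0 d Hd eps He) as (del & Hdel & H).
    exists del. split; [exact Hdel |]. intros z Hz. apply H.
    replace (z - 0)%C with z by ring. lra.
Qed.

(** On the unit circle z + 1/z = 2 cos t is real, while (F(z) - F(0)) (z + 1/z) tends to F'(0) at
    the origin, so [circle_mean] applies to this product. The subtracted constant contributes
    nothing because cos has mean zero. *)
Lemma cos_moment (F : C -> C) (d : C) :
  (forall z, Cmod z <= 1 -> exists d, cderiv F z d) -> cderiv F 0 d ->
  ex_RInt (fun t => cos t * Re (F (cis t))) 0 (2 * PI) /\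
  RInt (fun t => cos t * Re (F (cis t))) 0 (2 * PI) = PI * Re d.
Proof.
  intros HF Hd.
  destruct (circle_mean (fun z => (F z - F 0%R) * (z + / z))%C d) as [Hex HI].
  - intros z Hz. destruct (HF z ltac:(lra)) as [e He]. eexists.
    apply cderiv_mult.
    + apply cderiv_minus; [exact He | apply cderiv_const].
    + apply cderiv_plus; [apply cderiv_id |].
      apply cderiv_inv, Cmod_neq_0. lra.
  - intros eps Heps.
    assert (He : 0 < Rmin 1 (eps / 2)) by (apply Rmin_glb_lt; lra).
    destruct (proj1 (cderiv_eps F 0 d) Hd _ He) as (del & Hdel & H).
    pose proof (Cmod_ge_0 d).
    set (r := Rmin 1 (eps / (2 * (Cmod d + 2)))).
    assert (Hr : 0 < r).
    { apply Rmin_glb_lt; [lra | apply Rdiv_lt_0_compat; lra]. }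
    exists (Rmin del r). split; [apply Rmin_glb_lt; assumption |].
    intros z [Hz0 Hz].
    assert (H1 : Cmod z < del) by (eapply Rlt_le_trans; [exact Hz | apply Rmin_l]).
    assert (H2 : Cmod z < r) by (eapply Rlt_le_trans; [exact Hz | apply Rmin_r]).
    assert (H3 : Cmod z < 1) by (eapply Rlt_le_trans; [exact H2 | apply Rmin_l]).
    assert (H4 : Cmod z < eps / (2 * (Cmod d + 2))) by (eapply Rlt_le_trans; [exact H2 | apply Rmin_r]).
    apply Rlt_div_r in H4; [| lra].
    specialize (H z). replace (z - 0%R)%C with z in H by ring. specialize (H H1).
    set (E := (F z - F 0%R - z * d)%C) in *.
    assert (Hz' := Cmod_neq_0 z Hz0).
    (* E = F(z) - F(0) - z d is o(z), so even E / z is small; the other two terms vanish with z. *)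
    replace ((F z - F 0%R) * (z + / z) - d)%C
      with (E * z + z * z * d + E * / z)%C by (unfold E; field; exact Hz').
    eapply Rle_trans; [apply Cmod_triangle |].
    eapply Rle_trans; [apply Rplus_le_compat_r, Cmod_triangle |].
    rewrite !Cmod_mult, Cmod_inv by exact Hz'.
    assert (HE : Cmod E * / Cmod z <= eps / 2).
    { apply Rle_div_l; [exact Hz0 |]. eapply Rle_trans; [exact H |].
      apply Rmult_le_compat_r; [lra | apply Rmin_r]. }
    assert (HE1 : Cmod E <= 1 * Cmod z).
    { eapply Rle_trans; [exact H |]. apply Rmult_le_compat_r; [lra | apply Rmin_l]. }
    pose proof (Cmod_ge_0 E). nra.
  - assert (Hpt : forall t, Re ((F (cis t) - F 0%R) * (cis t + / cis t))%C =
        2 * (cos t * Re (F (cis t))) - 2 * Re (F 0%R) * cos t).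
    { intros t. rewrite cis_inv. unfold cis, Re, Im. simpl. ring. }
    assert (Hcos : ex_RInt (fun t => 2 * Re (F 0%R) * cos t) 0 (2 * PI)).
    { apply continuous_ex_RIntR. intros t.
      apply ex_derive_continuousR. auto_derive. exact I. }
    assert (Hc0 : RInt (fun t => 2 * Re (F 0%R) * cos t) 0 (2 * PI) = 0).
    { transitivity (2 * Re (F 0%R) * RInt cos 0 (2 * PI)).
      - apply (RInt_scal cos). apply continuous_ex_RIntR.
        intros t. apply ex_derive_continuousR. auto_derive. exact I.
      - rewrite RInt_cos_period. eqR; ring. }
    assert (Hsum : forall t, / 2 * (Re ((F (cis t) - F 0%R) * (cis t + / cis t))%C
        + 2 * Re (F 0%R) * cos t) = cos t * Re (F (cis t))).
    { intros t. rewrite Hpt. field. }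
    pose proof (ex_RInt_plus _ _ _ _ Hex Hcos) as Hp.
    split.
    + apply ex_RInt_ext with (2 := ex_RInt_scal _ _ _ (/ 2) Hp).
      intros t _. apply Hsum.
    + transitivity (/ 2 *
        (RInt (fun t => Re ((F (cis t) - F 0%R) * (cis t + / cis t))%C) 0 (2 * PI) +
         RInt (fun t => 2 * Re (F 0%R) * cos t) 0 (2 * PI))).
      2:{ rewrite HI, Hc0. eqR. field. }
      transitivity (/ 2 * RInt (fun t => Re ((F (cis t) - F 0%R) * (cis t + / cis t))%C
        + 2 * Re (F 0%R) * cos t) 0 (2 * PI)).
      * etransitivity; [| apply (RInt_scal _ _ _ (/ 2) Hp)]. apply RInt_ext.
        intros t _. symmetry. apply Hsum.
      * apply f_equal. apply (RInt_plus _ _ _ _ Hex Hcos).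
Qed.

Definition poisson (q t : R) : R := (1 - q ^ 2) / (1 - 2 * q * cos t + q ^ 2).

Lemma poisson_den_pos (q t : R) : 0 <= q < 1 -> 0 < 1 - 2 * q * cos t + q ^ 2.
Proof. intros Hq. pose proof (COS_bound t). nra. Qed.

(* [moebius_angle q] is the argument of [(e^{it} - q) / (1 - q e^{it})]. *)
Definition moebius_angle (q t : R) : R := t + 2 * atan (q * sin t / (1 - q * cos t)).

(** The boundary speed of a disc automorphism is the Poisson kernel; this is what turns the mean
    value property into Poisson's formula by substitution. *)
Lemma is_derive_moebius_angle (q t : R) : 0 <= q < 1 ->
  is_derive (moebius_angle q) t (poisson q t).
Proof.
  intros Hq. pose proof (COS_bound t). pose proof (poisson_den_pos q t Hq) as HP.
  assert (HD : 0 < 1 - q * cos t) by nra.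
  unfold moebius_angle, poisson. auto_derive; [lra |].
  pose proof (sin2_cos2 t) as E. unfold Rsqr in E.
  assert (Hs : sin t * sin t = 1 - cos t * cos t) by lra.
  set (s := sin t) in *. set (c := cos t) in *.
  assert (HN : (1 - q * c) ^ 2 + (q * s) ^ 2 = 1 - 2 * q * c + q ^ 2) by nra.
  transitivity (1 + 2 * ((q * c * (1 - q * c) - (q * s) ^ 2) / ((1 - q * c) ^ 2 + (q * s) ^ 2))).
  - field. repeat split; lra.
  - rewrite HN. replace ((q * s) ^ 2) with (q ^ 2 * (1 - c * c)) by (rewrite <- Hs; ring).
    field. lra.
Qed.

Lemma cos_sin_2atan (x : R) :
  cos (2 * atan x) = (1 - x * x) / (1 + x * x) /\ sin (2 * atan x) = 2 * x / (1 + x * x).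
Proof.
  assert (Hx : 0 < 1 + x * x) by nra.
  pose proof (sqrt_lt_R0 _ Hx) as Hs. pose proof (sqrt_sqrt _ (Rlt_le _ _ Hx)) as Hss.
  rewrite cos_2a, sin_2a, cos_atan, sin_atan. unfold Rsqr.
  assert (E : / sqrt (1 + x * x) * / sqrt (1 + x * x) = / (1 + x * x)).
  { rewrite <- Rinv_mult, Hss. reflexivity. }
  unfold Rdiv. rewrite <- E. split; ring.
Qed.

(** Since e^(it) - q = e^(it) times the conjugate of 1 - q e^(it), the quotient has argument t plus
    twice the argument of that conjugate, which is the arctangent in [moebius_angle]. *)
Lemma cis_moebius_angle (q t : R) : 0 <= q < 1 ->
  ((1 - RtoC q * cis t) * cis (moebius_angle q t) = cis t - RtoC q)%C.
Proof.
  intros Hq. pose proof (COS_bound t).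
  assert (HD : 0 < 1 - q * cos t) by nra.
  pose proof (sin2_cos2 t) as E. unfold Rsqr in E.
  unfold moebius_angle, cis. rewrite cos_plus, sin_plus.
  destruct (cos_sin_2atan (q * sin t / (1 - q * cos t))) as [-> ->].
  set (s := sin t) in *. set (c := cos t) in *.
  assert (HN : 0 < (1 - q * c) ^ 2 + (q * s) ^ 2) by nra.
  replace ((1 - q * s / (1 - q * c) * (q * s / (1 - q * c))) /
     (1 + q * s / (1 - q * c) * (q * s / (1 - q * c))))
    with (((1 - q * c) ^ 2 - (q * s) ^ 2) / ((1 - q * c) ^ 2 + (q * s) ^ 2))
    by (field; split; [nra | lra]).
  replace (2 * (q * s / (1 - q * c)) / (1 + q * s / (1 - q * c) * (q * s / (1 - q * c))))
    with (2 * (1 - q * c) * (q * s) / ((1 - q * c) ^ 2 + (q * s) ^ 2))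
    by (field; split; [nra | lra]).
  unfold RtoC, Cminus, Cplus, Cmult, Copp. cbn [fst snd]. f_equal.
  - transitivity (c * (1 - q * c) - s * (q * s)); [field; lra | nra].
  - transitivity (s * (1 - q * c) + c * (q * s)); [field; lra | ring].
Qed.

Lemma moebius_den (q : R) (z : C) : 0 <= q < 1 -> Cmod z <= 1 -> (1 + RtoC q * z)%C <> 0.
Proof.
  intros Hq Hz E.
  assert (Cmod (RtoC q * z) = 1).
  { replace (RtoC q * z)%C with (1 + RtoC q * z + - (1))%C by ring.
    rewrite E. replace (0 + - (1))%C with (- (1))%C by ring. apply Cmod_m1. }
  rewrite Cmod_mult, Cmod_R, Rabs_pos_eq in H by lra. nra.
Qed.

Lemma moebius_disc (q : R) (z : C) : 0 <= q < 1 -> Cmod z <= 1 ->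
  Cmod ((z + RtoC q) / (1 + RtoC q * z)) <= 1.
Proof.
  intros Hq Hz. pose proof (moebius_den q z Hq Hz) as Hd.
  rewrite Cmod_div by exact Hd.
  apply Cmod_gt_0 in Hd.
  apply Rle_div_l; [exact Hd |]. rewrite Rmult_1_l.
  apply Rsqr_incr_0_var; [| lra]. rewrite !Rsqr_pow2, !Cmod2_alt.
  assert (A : Cmod z ^ 2 <= 1) by (pose proof (Cmod_ge_0 z); nra).
  rewrite Cmod2_alt in A. destruct z as [x y].
  unfold Re, Im in *. simpl in *.
  pose proof (Rmult_le_pos (1 - q * q) (1 - (x * x + y * y)) ltac:(nra) ltac:(lra)). lra.
Qed.

(** The mean value property of F composed with the automorphism [m], which sends 0 to q. The
    substitution by [moebius_angle] undoes [m] on the circle and produces the kernel as its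
    derivative. *)
Lemma poisson_formula (F : C -> C) (q : R) : 0 <= q < 1 ->
  (forall z, Cmod z <= 1 -> exists d, cderiv F z d) ->
  ex_RInt (fun t => poisson q t * Re (F (cis t))) 0 (2 * PI) /\
  RInt (fun t => poisson q t * Re (F (cis t))) 0 (2 * PI) = 2 * PI * Re (F (RtoC q)).
Proof.
  intros Hq HF.
  set (m := fun z : C => ((z + RtoC q) * / (1 + RtoC q * z))%C).
  assert (Hm : forall z, Cmod z <= 1 -> exists d, cderiv (fun z => F (m z)) z d).
  { intros z Hz. destruct (HF (m z)) as [d Hd]; [apply moebius_disc; assumption |].
    eexists. apply cderiv_comp; [exact Hd |]. unfold m.
    apply cderiv_mult.
    - apply cderiv_plus; [apply cderiv_id | apply cderiv_const].
    - apply (cderiv_comp Cinv (fun z => 1 + RtoC q * z)%C).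
      + apply cderiv_inv, moebius_den; assumption.
      + apply cderiv_plus; [apply cderiv_const |].
        apply cderiv_mult; [apply cderiv_const | apply cderiv_id]. }
  assert (Hcont : forall G : C -> C, (forall z, Cmod z <= 1 -> exists d, cderiv G z d) ->
     forall t, continuous (fun s => Re (G (cis s))) t).
  { intros G HG t. destruct (HG (cis t)) as [d Hd]; [rewrite Cmod_cis; lra |].
    destruct (cderiv_differentiable G (cos t) (sin t) d Hd) as [D _].
    apply ex_derive_continuousR. eexists. apply is_derive_Reals.
    apply (derivable_pt_lim_comp_2d (fun u v => Re (G (u, v))) cos sin);
      [exact D | apply derivable_pt_lim_cos | apply derivable_pt_lim_sin]. }
  assert (Hpc : forall t, continuous (poisson q) t).
  { intros t. apply ex_derive_continuousR. unfold poisson. auto_derive.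
    pose proof (poisson_den_pos q t Hq). simpl in *. lra. }
  split.
  { apply continuous_ex_RIntR. intros t.
    apply (continuous_mult (poisson q) (fun s => Re (F (cis s)))); [apply Hpc |].
    apply Hcont, HF. }
  destruct (mean_value _ Hm) as [_ HI].
  replace (F (m 0%R)) with (F (RtoC q)) in HI.
  2:{ f_equal. unfold m. field. }
  rewrite <- HI.
  rewrite <- (RInt_ext (fun t => scal (poisson q t) (Re (F (m (cis (moebius_angle q t))))))).
  2:{ intros t _. unfold scal; simpl; unfold mult; simpl. do 3 f_equal.
      unfold m.
      assert (Hz : Cmod (cis t) <= 1) by (rewrite Cmod_cis; lra).
      assert (Hw : Cmod (cis (moebius_angle q t)) <= 1) by (rewrite Cmod_cis; lra).
      pose proof (moebius_den q _ Hq Hw) as H1.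
      pose proof (cis_moebius_angle q t Hq) as E.
      set (w := cis (moebius_angle q t)) in *.
      replace (w + RtoC q)%C with (cis t * (1 + RtoC q * w))%C.
      - field. exact H1.
      - transitivity (cis t - RtoC q + RtoC q * cis t * w + RtoC q)%C; [ring |].
        rewrite <- E. ring. }
  rewrite (RInt_comp (fun s => Re (F (m (cis s)))) (moebius_angle q) (poisson q)).
  (* The arctangent form of the angle fixes both 0 and 2 pi, so the limits of integration do not
     move. *)
  - unfold moebius_angle. rewrite sin_0, sin_2PI. unfold Rdiv.
    rewrite !Rmult_0_r, !Rmult_0_l, atan_0, Rmult_0_r, !Rplus_0_r. reflexivity.
  - intros t _. apply (Hcont _ Hm).
  - intros t _. split; [apply is_derive_moebius_angle, Hq | apply Hpc].
Qed.

(** * Functions with nonnegative real part *)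

Lemma chord_closed_disc (F : C -> C) (d : C) (q : R) : 0 <= q < 1 ->
  (forall z, Cmod z <= 1 -> exists d, cderiv F z d) ->
  (forall z, Cmod z <= 1 -> 0 <= Re (F z)) -> cderiv F 0 d ->
  (1 - q ^ 2) * Re (F (RtoC q)) <= (1 + q ^ 2) * Re (F 0) + q * Re d.
Proof.
  intros Hq HF Hpos Hd.
  destruct (mean_value F HF) as [E0 I0].
  destruct (cos_moment F d HF Hd) as [E1 I1].
  destruct (poisson_formula F q Hq HF) as [E2 I2].
  pose proof (is_RInt_scal _ _ _ (1 + q ^ 2) _ (RInt_correct _ _ _ E0)) as J0.
  pose proof (is_RInt_scal _ _ _ (2 * q) _ (RInt_correct _ _ _ E1)) as J1.
  pose proof (is_RInt_scal _ _ _ (1 - q ^ 2) _ (RInt_correct _ _ _ E2)) as J2.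
  pose proof (is_RInt_minus _ _ _ _ _ _ (is_RInt_plus _ _ _ _ _ _ J0 J1) J2) as J.
  pose proof PI_RGT_0 as Hpi.
  apply is_RInt_ge_0 in J; [| lra |].
  - rewrite I0, I1, I2 in J.
    unfold minus, plus, opp, scal in J; simpl in J; unfold mult in J; simpl in J.
    apply Rmult_le_reg_l with (2 * PI); [lra |]. lra.
  - intros t _. unfold minus, plus, opp, scal; simpl; unfold mult; simpl.
    pose proof (Hpos (cis t) ltac:(rewrite Cmod_cis; lra)) as HR.
    pose proof (poisson_den_pos q t Hq) as Hden.
    (* As a function of cos t, (1 - q^2) times the kernel equals (1 + q)^2 and (1 - q)^2 at the ends
       1 and -1; the chord through these values is 1 + q^2 + 2 q cos t. *)
    assert (K : 0 <= (1 + q ^ 2) + 2 * q * cos t - (1 - q ^ 2) * poisson q t).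
    { replace ((1 + q ^ 2) + 2 * q * cos t - (1 - q ^ 2) * poisson q t)
        with (4 * q ^ 2 * (1 - cos t * cos t) / (1 - 2 * q * cos t + q ^ 2))
        by (unfold poisson; field; lra).
      apply Rle_div_r; [exact Hden |]. pose proof (COS_bound t).
      assert (0 <= q ^ 2) by nra. assert (0 <= 1 - cos t * cos t) by nra. nra. }
    pose proof (Rmult_le_pos _ _ K HR) as KR. simpl in KR. lra.
Qed.

Lemma unimodular_dual (D : C) : exists u, Cmod u = 1 /\ (u * D)%C = RtoC (Cmod D).
Proof.
  destruct (Req_dec (Cmod D) 0) as [E | E].
  - exists 1. rewrite Cmod_1, E, (Cmod_eq_0 _ E). split; [reflexivity | ring].
  - assert (HD : RtoC (Cmod D) <> 0) by (intros H; apply RtoC_inj in H; contradiction).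
    exists (Cconj D / RtoC (Cmod D))%C. split.
    + rewrite Cmod_div, Cmod_conj, Cmod_R, Rabs_pos_eq by (apply Cmod_ge_0 || exact HD).
      field. exact E.
    + replace (Cconj D / RtoC (Cmod D) * D)%C with (D * Cconj D / RtoC (Cmod D))%C
        by (field; exact HD).
      rewrite <- Cmod2_conj, RtoC_pow. field. exact HD.
Qed.

Lemma cderiv_scale (F : C -> C) (c z d : C) :
  cderiv F (c * z)%C d -> cderiv (fun w => F (c * w)%C) z (c * d)%C.
Proof.
  intros H. apply (cderiv_comp F (fun w => c * w)%C); [exact H |].
  pose proof (cderiv_mult (fun _ => c) (fun w => w) z _ _ (cderiv_const c z) (cderiv_id z)) as H1.
  cbv beta in H1. replace (0 * z + c * 1)%C with c in H1 by ring. exact H1.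
Qed.

(* On each circle the Poisson kernel is a convex function of [cos t]; bounding it by its
   chord leaves only the mean and the first Fourier coefficient of [Re F]. *)
Lemma chord (F : C -> C) (d z : C) :
  (forall w, Cmod w < 1 -> exists d, cderiv F w d) ->
  (forall w, Cmod w < 1 -> 0 <= Re (F w)) -> cderiv F 0 d -> Cmod z < 1 ->
  (1 - Cmod z ^ 2) * Re (F z) <= (1 + Cmod z ^ 2) * Re (F 0) + Re (z * d)%C.
Proof.
  intros HF Hpos Hd Hz.
  pose proof (Cmod_ge_0 z) as Hz0.
  destruct (Req_dec (Cmod z) 0) as [E | E].
  { rewrite E, (Cmod_eq_0 _ E). replace (0 * d)%C with (RtoC 0) by ring. rewrite re_RtoC. lra. }
  set (X := Re (F z)) in *. set (Y := Re (F 0)) in *. set (Z := Re (z * d)%C) in *.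
  set (p := Cmod z) in *.
  assert (HX : 0 <= X) by (apply Hpos; exact Hz).
  assert (HY : 0 <= Y) by (apply Hpos; rewrite Cmod_0; lra).
  (* The closed-disc version for F(c w), where |c| = r and c p / r = z: this rotates z to the
     positive axis and moves the unit circle inside the domain. *)
  assert (Hr : forall r, p < r < 1 -> r ^ 2 * (X - Y - Z) <= p ^ 2 * (X + Y)).
  { intros r Hr.
    assert (Hp0 : RtoC p <> 0) by (intros H; apply RtoC_inj in H; contradiction).
    set (c := (RtoC (r / p) * z)%C).
    assert (Hc : Cmod c = r).
    { unfold c. rewrite Cmod_mult, Cmod_R, Rabs_pos_eq.
      - fold p. field. lra.
      - apply Rlt_le, Rdiv_lt_0_compat; lra. }
    assert (Hin : forall w, Cmod w <= 1 -> Cmod (c * w)%C < 1).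
    { intros w Hw. rewrite Cmod_mult, Hc. pose proof (Cmod_ge_0 w). nra. }
    assert (Hq : 0 <= p / r < 1).
    { split; [apply Rle_div_r; lra | apply Rlt_div_l; lra]. }
    pose proof (chord_closed_disc (fun w => F (c * w)%C) (c * d)%C (p / r) Hq) as Hch.
    assert (Ez : (c * RtoC (p / r))%C = z).
    { unfold c. transitivity (RtoC (r / p * (p / r)) * z)%C; [rewrite RtoC_mult; ring |].
      replace (r / p * (p / r)) with 1 by (field; lra). ring. }
    cbv beta in Hch. rewrite Ez in Hch. replace (c * 0%R)%C with (RtoC 0) in Hch by ring.
    fold X Y in Hch. rewrite <- re_scal_l in Hch.
    replace (RtoC (p / r) * (c * d))%C with (c * RtoC (p / r) * d)%C in Hch by ring.
    rewrite Ez in Hch. fold Z in Hch.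
    assert (H : (1 - (p / r) ^ 2) * X <= (1 + (p / r) ^ 2) * Y + Z).
    { apply Hch.
      - intros w Hw. destruct (HF _ (Hin w Hw)) as [e He].
        eexists. apply cderiv_scale, He.
      - intros w Hw. apply Hpos, Hin, Hw.
      - apply cderiv_scale. replace (c * 0)%C with (RtoC 0) by ring. exact Hd. }
    apply (Rmult_le_compat_l (r ^ 2)) in H; [| nra].
    replace (r ^ 2 * ((1 - (p / r) ^ 2) * X)) with ((r ^ 2 - p ^ 2) * X) in H by (field; lra).
    replace (r ^ 2 * ((1 + (p / r) ^ 2) * Y + Z)) with ((r ^ 2 + p ^ 2) * Y + r ^ 2 * Z) in H
      by (field; lra).
    lra. }
  (* The limit r -> 1 by contradiction: if A > B, an r with r^2 > B / A violates [Hr]. Any r above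
     (1 + b) / 2 qualifies, since ((1 + b) / 2)^2 >= b. *)
  destruct (Rle_lt_dec (X - Y - Z) (p ^ 2 * (X + Y))) as [L | L]; [lra | exfalso].
  set (A := X - Y - Z) in *. set (B := p ^ 2 * (X + Y)) in *.
  assert (HB : 0 <= B) by (unfold B; nra).
  assert (Hb : 0 <= B / A < 1).
  { split; [apply Rle_div_r; lra | apply Rlt_div_l; lra]. }
  assert (EB : B = B / A * A) by (field; lra).
  set (b := B / A) in *.
  pose proof (Rmax_l p ((1 + b) / 2)). pose proof (Rmax_r p ((1 + b) / 2)).
  assert (Rmax p ((1 + b) / 2) < 1) by (apply Rmax_lub_lt; lra).
  pose proof (Hr ((1 + Rmax p ((1 + b) / 2)) / 2) ltac:(lra)) as H2.
  set (r := (1 + Rmax p ((1 + b) / 2)) / 2) in *.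
  assert (b < r ^ 2).
  { assert ((1 + b) / 2 < r) by (unfold r; lra). nra. }
  rewrite EB in H2. nra.
Qed.

(** * Two consequences: Borel-Caratheodory and the second-order Schwarz lemma *)

Lemma borel_caratheodory (f : C -> C) (d : C) (r M : R) : 0 < r <= 1 ->
  (forall w, Cmod w < 1 -> exists d, cderiv f w d) ->
  (forall w, Cmod w < r -> Re (f w) <= M) -> cderiv f 0 d ->
  r * Cmod d <= 2 * (M - Re (f 0)).
Proof.
  intros Hr Hf HM Hd.
  set (F := fun w => (RtoC M - f (RtoC r * w))%C).
  assert (Hin : forall w, Cmod w < 1 -> Cmod (RtoC r * w) < r).
  { intros w Hw. rewrite Cmod_mult, Cmod_R, Rabs_pos_eq by lra.
    pose proof (Cmod_ge_0 w). nra. }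
  assert (HF : forall w, Cmod w < 1 -> exists d, cderiv F w d).
  { intros w Hw. destruct (Hf (RtoC r * w)%C) as [e He].
    - pose proof (Hin w Hw). lra.
    - eexists. apply cderiv_minus; [apply cderiv_const | apply cderiv_scale, He]. }
  assert (Hre : forall w, Re (F w) = M - Re (f (RtoC r * w)%C)).
  { intros w. unfold F, Re. simpl. ring. }
  assert (Hpos : forall w, Cmod w < 1 -> 0 <= Re (F w)).
  { intros w Hw. rewrite Hre. pose proof (HM _ (Hin w Hw)). lra. }
  assert (HF0 : cderiv F 0 (0 - RtoC r * d)).
  { apply cderiv_minus; [apply cderiv_const |]. apply cderiv_scale.
    replace (RtoC r * 0)%C with (RtoC 0) by ring. exact Hd. }
  set (Y := M - Re (f 0)).
  assert (HY : Re (F 0) = Y).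
  { rewrite Hre. replace (RtoC r * 0%R)%C with (RtoC 0) by ring. reflexivity. }
  assert (HY0 : 0 <= Y) by (rewrite <- HY; apply Hpos; rewrite Cmod_0; lra).
  destruct (unimodular_dual d) as (u & Hu & Hud).
  set (D := r * Cmod d).
  assert (Hp : forall p, 0 < p < 1 -> p * D <= (1 + p ^ 2) * Y).
  { intros p Hp.
    assert (Hz : Cmod (RtoC p * u) = p).
    { rewrite Cmod_mult, Hu, Cmod_R, Rabs_pos_eq; lra. }
    pose proof (chord F _ (RtoC p * u)%C HF Hpos HF0) as H.
    rewrite Hz, HY in H. specialize (H ltac:(lra)).
    replace (RtoC p * u * (0 - RtoC r * d))%C with (RtoC (- (p * r)) * (u * d))%C in H
      by (rewrite RtoC_opp, RtoC_mult; ring).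
    rewrite Hud, re_scal_l, re_RtoC in H.
    pose proof (Hpos (RtoC p * u)%C ltac:(lra)).
    assert (0 <= (1 - p ^ 2) * Re (F (RtoC p * u)%C)) by (apply Rmult_le_pos; nra).
    unfold D. nra. }
  (* With excess e = D - 2 Y > 0, the inequality at p = 1 - s gives e <= s (e + s Y), whereas the
     chosen s makes s (e + Y) = e / 2. *)
  destruct (Rle_lt_dec D (2 * Y)) as [L | L]; [exact L | exfalso].
  set (e := D - 2 * Y) in *.
  assert (He : 0 < e) by (unfold e; lra).
  set (s := e / (2 * (Y + e))).
  assert (Hs : 0 < s <= / 2).
  { split; [apply Rdiv_lt_0_compat; lra |]. apply Rle_div_l; lra. }
  assert (HsY : s * Y <= e / 2).
  { assert (s * (Y + e) = e / 2) by (unfold s; field; lra). nra. }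
  pose proof (Hp (1 - s) ltac:(lra)) as H.
  replace D with (e + 2 * Y) in H by (unfold e; ring). nra.
Qed.

(** [chord] for the Cayley transform (1 + v g) / (1 - v g), whose value and derivative at 0 are 1
    and 2 v a, with v chosen so that v g(z) = |g(z)|. Solving for |g(z)| gives |z| (|z| + |a|) / (1
    + |z| |a|), and the denominator is dropped. *)
Lemma schwarz_order2 (g : C -> C) (a z : C) :
  (forall w, Cmod w < 1 -> exists d, cderiv g w d) ->
  (forall w, Cmod w < 1 -> Cmod (g w) < 1) -> g 0 = 0 -> cderiv g 0 a -> Cmod z < 1 ->
  Cmod (g z) <= Cmod z * (Cmod z + Cmod a).
Proof.
  intros Hg Hb Hg0 Ha Hz.
  destruct (unimodular_dual (g z)) as (v & Hv & Hvg).
  assert (Hv1 : forall w, Cmod w < 1 -> Cmod (v * g w) < 1).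
  { intros w Hw. rewrite Cmod_mult, Hv, Rmult_1_l. apply Hb, Hw. }
  assert (Hden : forall w, Cmod w < 1 -> (1 - v * g w)%C <> 0).
  { intros w Hw E. pose proof (Hv1 w Hw) as H.
    replace (v * g w)%C with (1 - (1 - v * g w))%C in H by ring.
    rewrite E in H. replace (1 - 0)%C with (RtoC 1) in H by ring. rewrite Cmod_1 in H. lra. }
  set (F := fun w => ((1 + v * g w) * / (1 - v * g w))%C).
  assert (HD : forall w d, Cmod w < 1 -> cderiv g w d ->
     cderiv F w (v * d * / (1 - v * g w) + (1 + v * g w) *
       (- (v * d) * - / ((1 - v * g w) * (1 - v * g w))))%C).
  { intros w d Hw Hd.
    assert (Hvd : cderiv (fun w => v * g w)%C w (v * d)%C).
    { replace (v * d)%C with (0 * g w + v * d)%C by ring.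
      apply cderiv_mult; [apply cderiv_const | exact Hd]. }
    apply (cderiv_mult (fun w => 1 + v * g w)%C (fun w => / (1 - v * g w))%C).
    - replace (v * d)%C with (0 + v * d)%C by ring.
      apply cderiv_plus; [apply cderiv_const | exact Hvd].
    - apply (cderiv_comp Cinv (fun w => 1 - v * g w)%C); [apply cderiv_inv, Hden, Hw |].
      replace (- (v * d))%C with (0 - v * d)%C by ring.
      apply cderiv_minus; [apply cderiv_const | exact Hvd]. }
  assert (Hre : forall w, Cmod w < 1 -> 0 <= Re (F w)).
  { intros w Hw. pose proof (Hv1 w Hw) as H1. pose proof (Hden w Hw) as H2.
    unfold F. set (x := (v * g w)%C) in *.
    assert (H3 : Cmod x ^ 2 <= 1) by (pose proof (Cmod_ge_0 x); nra).
    rewrite Cmod2_alt in H3. apply Cmod_gt_0 in H2.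
    assert (H4 : 0 < Cmod (1 - x) ^ 2) by nra. rewrite Cmod2_alt in H4.
    destruct x as [x y]. unfold Re, Im, Cinv, Cminus, Cplus, Cmult, Copp, RtoC in *. cbn [fst snd] in *.
    match goal with |- 0 <= ?E => replace E with
      ((1 - (x ^ 2 + y ^ 2)) / ((1 + - x) ^ 2 + (0 + - y) ^ 2)) by (field; lra) end.
    apply Rle_div_r; lra. }
  assert (H0 : Cmod 0 < 1) by (rewrite Cmod_0; lra).
  assert (HFd : forall w, Cmod w < 1 -> exists d, cderiv F w d).
  { intros w Hw. destruct (Hg w Hw) as [d Hd]. eexists. apply HD; eassumption. }
  pose proof (chord F _ z HFd Hre (HD 0 a H0 Ha) Hz) as H.
  assert (EF0 : Re (F 0) = 1).
  { unfold F. rewrite Hg0. replace ((1 + v * 0%R) * / (1 - v * 0%R))%C with (RtoC 1).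
    - apply re_RtoC.
    - field. }
  rewrite Hg0 in H.
  match type of H with context [(z * ?D)%C] => replace (z * D)%C with (RtoC 2 * (z * v * a))%C in H by field end.
  rewrite EF0, re_scal_l in H.
  assert (Hza : Re (z * v * a)%C <= Cmod z * Cmod a).
  { eapply Rle_trans; [apply Rle_abs |]. eapply Rle_trans; [apply re_le_Cmod |].
    rewrite !Cmod_mult, Hv. lra. }
  pose proof (Hb z Hz) as Hgz. pose proof (Cmod_ge_0 (g z)) as Hg1.
  unfold F in H. rewrite Hvg in H.
  replace ((1 + RtoC (Cmod (g z))) * / (1 - RtoC (Cmod (g z))))%C
    with (RtoC ((1 + Cmod (g z)) / (1 - Cmod (g z)))) in H.
  2:{ rewrite RtoC_div, RtoC_plus, RtoC_minus by lra. reflexivity. }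
  rewrite re_RtoC in H.
  set (G := Cmod (g z)) in *. set (p := Cmod z) in *.
  pose proof (Cmod_ge_0 z) as Hp0. pose proof (Cmod_ge_0 a) as Ha0. fold p in Hp0.
  apply (Rmult_le_compat_r (1 - G)) in H; [| lra].
  replace ((1 - p ^ 2) * ((1 + G) / (1 - G)) * (1 - G)) with ((1 - p ^ 2) * (1 + G)) in H
    by (field; lra).
  assert (HZ : 0 <= p * Cmod a) by (apply Rmult_le_pos; assumption).
  assert ((1 - p ^ 2) * (1 + G) <= (1 + p ^ 2 + 2 * (p * Cmod a)) * (1 - G)).
  { eapply Rle_trans; [exact H |]. apply Rmult_le_compat_r; lra. }
  assert (0 <= G * (p * Cmod a)) by (apply Rmult_le_pos; assumption).
  nra.
Qed.

(** * Analytic discs and lower bounds *)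

Lemma is_derive_pair (phi : C -> C * C) (z : C) (l : C * C) :
  @is_derive C_AbsRing (prod_NormedModule C_AbsRing C_NormedModule C_NormedModule) phi z l <->
  cderiv (fun w => fst (phi w)) z (fst l) /\ cderiv (fun w => snd (phi w)) z (snd l).
Proof.
  split.
  - intros [_ H].
    split; apply cderiv_eps; intros eps Heps;
      destruct (H z (fun P HP => HP) (mkposreal eps Heps)) as [d Hd];
      exists d; (split; [apply cond_pos |]); intros w Hw; specialize (Hd w Hw);
      (eapply Rle_trans; [| exact Hd]);
      (eapply Rle_trans; [| apply sqrt_plus_sqr]).
    + eapply Rle_trans; [| apply Rmax_l].
      rewrite Rabs_pos_eq by apply norm_ge_0. apply Rle_refl.
    + eapply Rle_trans; [| apply Rmax_r].
      rewrite Rabs_pos_eq by apply norm_ge_0. apply Rle_refl.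
  - intros [Hf Hg]. split; [apply is_linear_scal_l |].
    intros x Hx. apply (@is_filter_lim_locally_unique _ (AbsRing_NormedModule C_AbsRing)) in Hx. subst x.
    intros eps.
    assert (He : 0 < eps / 2) by (pose proof (cond_pos eps); lra).
    destruct (proj1 (cderiv_eps _ _ _) Hf _ He) as (d1 & Hd1 & H1).
    destruct (proj1 (cderiv_eps _ _ _) Hg _ He) as (d2 & Hd2 & H2).
    exists (mkposreal _ (Rmin_glb_lt _ _ _ Hd1 Hd2)). intros w B.
    assert (B1 : Cmod (w - z) < d1) by (eapply Rlt_le_trans; [exact B | apply Rmin_l]).
    assert (B2 : Cmod (w - z) < d2) by (eapply Rlt_le_trans; [exact B | apply Rmin_r]).
    specialize (H1 w B1). specialize (H2 w B2).
    set (A1 := Cmod (fst (phi w) - fst (phi z) - (w - z) * fst l)) in *.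
    set (A2 := Cmod (snd (phi w) - snd (phi z) - (w - z) * snd l)) in *.
    change (sqrt (A1 ^ 2 + A2 ^ 2) <= eps * Cmod (w - z)).
    pose proof (Cmod_ge_0 (fst (phi w) - fst (phi z) - (w - z) * fst l)) as P1. fold A1 in P1.
    pose proof (Cmod_ge_0 (snd (phi w) - snd (phi z) - (w - z) * snd l)) as P2. fold A2 in P2.
    apply Rle_trans with (A1 + A2); [| lra].
    rewrite <- (sqrt_pow2 (A1 + A2)) by lra. apply sqrt_le_1_alt. nra.
Qed.

Definition analytic_disc (psi : R -> R) (d : R) (v1 v2 : C) (f g : C -> C) : Prop :=
  (forall w, Cmod w < 1 -> exists l, cderiv f w l) /\
  (forall w, Cmod w < 1 -> exists l, cderiv g w l) /\
  (forall w, Cmod w < 1 -> Cmod (f w) < 1 /\ Cmod (g w) < 1 /\ Re (f w) < psi (Cmod (g w))) /\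
  f 0 = RtoC (- d) /\ g 0 = 0 /\ cderiv f 0 v1 /\ cderiv g 0 v2.

Lemma kobayashi_ge (psi : R -> R) (d : R) (xN xT : C) (B : R) :
  (forall lam f g, 0 < lam -> analytic_disc psi d (RtoC lam * xN)%C (RtoC lam * xT)%C f g ->
     B <= / lam) ->
  Rbar_le B (kobayashi (G_psi psi) (p_delta d) (xN, xT)).
Proof.
  intros H. apply (proj2 (Glb_Rbar_correct _)).
  intros m (lam & Hlam & -> & phi & Hphi & Hin & H0 & Hd).
  apply is_derive_pair in Hd. destruct Hd as [Hd1 Hd2].
  apply (H lam (fun w => fst (phi w)) (fun w => snd (phi w)) Hlam).
  assert (HD : forall w, Cmod w < 1 -> exists l, cderiv (fun w => fst (phi w)) w (fst l) /\
     cderiv (fun w => snd (phi w)) w (snd l)).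
  { intros w Hw. destruct (Hphi w Hw) as [l Hl]. exists l. apply is_derive_pair, Hl. }
  split; [| split; [| split; [| split; [| split; [| split]]]]].
  - intros w Hw. destruct (HD w Hw) as [l Hl]. exists (fst l). apply Hl.
  - intros w Hw. destruct (HD w Hw) as [l Hl]. exists (snd l). apply Hl.
  - exact Hin.
  - rewrite H0. reflexivity.
  - rewrite H0. reflexivity.
  - exact Hd1.
  - exact Hd2.
Qed.

Lemma kobayashi_le (psi : R -> R) (d : R) (xN xT : C) (lam : R) (f g : C -> C) :
  0 < lam -> analytic_disc psi d (RtoC lam * xN)%C (RtoC lam * xT)%C f g ->
  Rbar_le (kobayashi (G_psi psi) (p_delta d) (xN, xT)) (/ lam).
Proof.
  intros Hlam (Hf & Hg & Hin & Hf0 & Hg0 & Hfd & Hgd).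
  apply (proj1 (Glb_Rbar_correct _)).
  exists lam. split; [exact Hlam | split; [reflexivity |]].
  exists (fun w => (f w, g w)). split; [| split; [| split]].
  - intros w Hw. destruct (Hf w Hw) as [l1 H1]. destruct (Hg w Hw) as [l2 H2].
    exists (l1, l2). apply is_derive_pair. split; assumption.
  - intros w Hw. apply Hin, Hw.
  - rewrite Hf0, Hg0. reflexivity.
  - apply is_derive_pair. split; assumption.
Qed.

Definition nondecr (psi : R -> R) : Prop := forall x y, 0 <= x -> x <= y -> y <= 1 -> psi x <= psi y.

Lemma Cmod_scal (lam : R) (x : C) : 0 < lam -> Cmod (RtoC lam * x) = lam * Cmod x.
Proof. intros H. rewrite Cmod_mult, Cmod_R, Rabs_pos_eq; lra. Qed.

(** With r0 = sqrt (s / 2) and D = psi s the claim is r0 mu <= 4 D, which Borel-Caratheodory gives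
    at r = r0 if a <= r0. But the hypothesis only says 4 D a <= r0^2 mu, which yields a <= r0
    through the claim itself. The circle is broken by contradiction: if r0 mu = 4 D k with k > 1,
    then a <= k r0, and the radius r0 / q with 1 < q < k is still admissible but forces k <= q. *)
Lemma kobayashi_lower (psi : R -> R) (d s : R) (xN xT : C) :
  nondecr psi -> 0 < d -> 0 < s <= 1 -> d <= psi s ->
  8 * psi s * Cmod xT <= s * Cmod xN ->
  Rbar_le (/ (4 * sqrt 2) * (sqrt s / psi s) * Cmod xN)
    (kobayashi (G_psi psi) (p_delta d) (xN, xT)).
Proof.
  intros Hmono Hd Hs Hds Ht. apply kobayashi_ge.
  intros lam f g Hlam (Hf & Hg & Hin & Hf0 & Hg0 & Hfd & Hgd).
  set (D := psi s) in *.
  set (r0 := sqrt s / sqrt 2).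
  pose proof (sqrt_lt_R0 2 ltac:(lra)) as H2. pose proof (sqrt_sqrt 2 ltac:(lra)) as H22.
  pose proof (sqrt_lt_R0 s ltac:(lra)) as Hss. pose proof (sqrt_sqrt s ltac:(lra)) as Hsss.
  assert (Hr0 : 0 < r0) by (apply Rdiv_lt_0_compat; assumption).
  assert (Er0 : 2 * (r0 * r0) = s).
  { unfold r0.
    replace (sqrt s / sqrt 2 * (sqrt s / sqrt 2)) with (sqrt s * sqrt s / (sqrt 2 * sqrt 2))
      by (field; lra).
    rewrite H22, Hsss. field. }
  assert (Hr1 : r0 < 1) by nra.
  set (mu := lam * Cmod xN). set (a := lam * Cmod xT).
  assert (Ha0 : 0 <= a) by (apply Rmult_le_pos; [lra | apply Cmod_ge_0]).
  assert (Ha : 4 * D * a <= r0 * r0 * mu).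
  { unfold a, mu. apply (Rmult_le_compat_l lam) in Ht; [| lra]. rewrite <- Er0 in Ht. lra. }
  assert (Hmu : r0 * mu <= 4 * D).
  { destruct (Rle_lt_dec (r0 * mu) (4 * D)) as [L | L]; [exact L | exfalso].
    set (k := r0 * mu / (4 * D)).
    assert (Ek : r0 * mu = k * (4 * D)) by (unfold k; field; lra).
    assert (Hk : 1 < k) by nra.
    assert (Hak : a <= k * r0).
    { apply Rmult_le_reg_l with (4 * D); [lra |]. eapply Rle_trans; [exact Ha |].
      rewrite Rmult_assoc, Ek. lra. }
    (* Here k = 2 q - 1, so k q + 1 = 2 q^2 - (q - 1) <= 2 q^2; for r = r0 / q this says r (r + k
       r0) <= 2 r0^2 = s. *)
    set (q := (k + 1) / 2).
    assert (Hq : 1 < q < k) by (unfold q; lra).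
    assert (Hq2 : k * q + 1 <= 2 * (q * q)) by (unfold q; nra).
    set (r := r0 / q).
    assert (Er : r * q = r0) by (unfold r; field; lra).
    assert (Hr : 0 < r <= 1).
    { split; [apply Rdiv_lt_0_compat; lra |]. apply Rle_div_l; lra. }
    assert (HM : forall w, Cmod w < r -> Re (f w) <= D).
    { intros w Hw. destruct (Hin w ltac:(lra)) as (_ & Hgw & Hfw).
      apply Rlt_le, (Rlt_le_trans _ _ _ Hfw). apply Hmono; [apply Cmod_ge_0 | | lra].
      pose proof (schwarz_order2 g _ w Hg (fun w Hw => proj1 (proj2 (Hin w Hw))) Hg0 Hgd ltac:(lra)) as S.
      rewrite Cmod_scal in S by exact Hlam. fold a in S.
      eapply Rle_trans; [exact S |].
      pose proof (Cmod_ge_0 w).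
      apply Rle_trans with (r * (r + k * r0)).
      { apply Rmult_le_compat; lra. }
      rewrite <- Er0, <- Er.
      replace (r * (r + k * (r * q))) with ((r * r) * (k * q + 1)) by ring.
      replace (2 * (r * q * (r * q))) with ((r * r) * (2 * (q * q))) by ring.
      apply Rmult_le_compat_l; [nra | exact Hq2]. }
    pose proof (borel_caratheodory f _ r D Hr Hf HM Hfd) as BC.
    rewrite Cmod_scal, Hf0, re_RtoC in BC by exact Hlam. fold mu in BC.
    assert (r * mu * q <= 4 * D * q) by (apply Rmult_le_compat_r; lra).
    nra. }
  assert (HD : 0 < D) by lra.
  apply Rmult_le_reg_l with lam; [exact Hlam |]. rewrite Rinv_r by lra.
  replace (lam * (/ (4 * sqrt 2) * (sqrt s / D) * Cmod xN)) with (r0 * mu / (4 * D))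
    by (unfold r0, mu; field; split; lra).
  apply Rle_div_l; lra.
Qed.

(** Borel-Caratheodory would give mu <= 2 a + O(sqrt d), too weak for the difference mu - a.
    Applying [chord] to 1 - f at one point of modulus p = sqrt d keeps the coefficient of a at 1: p
    mu <= (1 + p^2)^2 - (1 - p^2) (1 - X) with X <= p (p + a), hence mu - a <= 5 p. *)
Lemma kobayashi_lower_id (d : R) (xN xT : C) : 0 < d < 1 ->
  Rbar_le (/ 5 * Rmax ((Cmod xN - Cmod xT) / sqrt d) (Cmod xT))
    (kobayashi (G_psi (fun x => x)) (p_delta d) (xN, xT)).
Proof.
  intros Hd. apply kobayashi_ge.
  intros lam f g Hlam (Hf & Hg & Hin & Hf0 & Hg0 & Hfd & Hgd).
  pose proof (sqrt_lt_R0 d ltac:(lra)) as Hs0. pose proof (sqrt_sqrt d ltac:(lra)) as Hss.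
  set (p := sqrt d) in *.
  assert (Hp1 : p < 1) by nra.
  apply Rmult_le_reg_l with lam; [exact Hlam |]. rewrite Rinv_r by lra.
  rewrite <- RmaxRmult by lra. rewrite <- RmaxRmult by lra.
  apply Rmax_lub.
  - set (mu := lam * Cmod xN). set (a := lam * Cmod xT).
    replace (lam * (/ 5 * ((Cmod xN - Cmod xT) / p))) with ((mu - a) / (5 * p))
      by (unfold mu, a; field; lra).
    apply Rle_div_l; [lra |]. rewrite Rmult_1_l.
    destruct (unimodular_dual xN) as (u & Hu & HuN).
    assert (Hz : Cmod (RtoC p * u) = p) by (rewrite Cmod_scal, Hu by exact Hs0; ring).
    assert (Hz1 : Cmod (RtoC p * u) < 1) by lra.
    pose proof (schwarz_order2 g _ _ Hg (fun w Hw => proj1 (proj2 (Hin w Hw))) Hg0 Hgd Hz1) as S.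
    rewrite Hz, Cmod_scal in S by exact Hlam. fold a in S.
    assert (H1f : forall w l, cderiv f w l -> cderiv (fun w => 1 - f w)%C w (0 - l)).
    { intros w l Hl. apply cderiv_minus; [apply cderiv_const | exact Hl]. }
    assert (Hre : forall w, Re (1 - f w)%C = 1 - Re (f w)) by (intros w; unfold Re; simpl; ring).
    pose proof (chord (fun w => 1 - f w)%C (0 - RtoC lam * xN)%C (RtoC p * u)%C) as Ch.
    cbv beta in Ch. rewrite !Hre, Hf0, re_RtoC, Hz in Ch.
    replace (RtoC p * u * (0 - RtoC lam * xN))%C with (RtoC (- (p * lam)) * (u * xN))%C in Ch
      by (rewrite RtoC_opp, RtoC_mult; ring).
    rewrite HuN, re_scal_l, re_RtoC in Ch.
    assert (Hfin : (1 - p ^ 2) * (1 - Re (f (RtoC p * u)%C)) <= (1 + p ^ 2) * (1 - - d) + - (p * lam) * Cmod xN).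
    { apply Ch.
      - intros w Hw. destruct (Hf w Hw) as [l Hl]. eexists. apply H1f, Hl.
      - intros w Hw. rewrite Hre. destruct (Hin w Hw) as [Hfw _].
        pose proof (re_le_Cmod (f w)). pose proof (Rle_abs (Re (f w))). lra.
      - apply H1f, Hfd.
      - exact Hp1. }
    destruct (Hin _ Hz1) as (_ & _ & Hfg).
    set (X := Re (f (RtoC p * u)%C)) in *.
    assert (HX : X <= p * (p + a)) by lra.
    assert (Ha0 : 0 <= a) by (apply Rmult_le_pos; [lra | apply Cmod_ge_0]).
    assert (HX2 : (1 - p ^ 2) * X <= p * (p + a)).
    { apply Rle_trans with ((1 - p ^ 2) * (p * (p + a))).
      - apply Rmult_le_compat_l; [nra | exact HX].
      - assert (0 <= p * (p + a)) by (apply Rmult_le_pos; lra).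
        assert (0 <= p ^ 2) by nra. nra. }
    apply Rmult_le_reg_l with p; [exact Hs0 |].
    replace (p * (mu - a)) with (p * lam * Cmod xN - p * a) by (unfold mu; ring).
    nra.
  (* With r = M = 1 this bounds lam |xT| by 2, which is enough for the constant 5. *)
  - pose proof (borel_caratheodory g (RtoC lam * xT)%C 1 1 ltac:(lra) Hg) as BC.
    rewrite Cmod_scal, Hg0, re_RtoC in BC by exact Hlam.
    assert (1 * (lam * Cmod xT) <= 2 * (1 - 0)).
    { apply BC; [| exact Hgd]. intros w Hw. destruct (Hin w Hw) as (_ & Hgw & _).
      pose proof (re_le_Cmod (g w)). pose proof (Rle_abs (Re (g w))). lra. }
    lra.
Qed.

(** * Upper bounds *)

Lemma polar_form (z : C) : exists u, Cmod u = 1 /\ z = (RtoC (Cmod z) * u)%C.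
Proof.
  destruct (unimodular_dual z) as (v & Hv & E).
  assert (Hv0 : v <> 0) by (apply Cmod_neq_0; lra).
  exists (/ v)%C. split.
  - rewrite Cmod_inv, Hv by exact Hv0. field.
  - rewrite <- E. field. exact Hv0.
Qed.

(** Reduces the choice of a disc to an inequality in one real variable, x = Re (u w): for x <= 0 the
    first component has negative real part, and for x > 0 the second has modulus at least x (a + x /
    2), so that monotonicity of psi applies. *)
Lemma kobayashi_upper (psi : R -> R) (d lam : R) (xN xT : C) :
  (forall x, 0 <= x <= 1 -> 0 <= psi x) -> nondecr psi -> 0 < lam -> 0 < d ->
  d + lam * Cmod xN < 1 -> lam * Cmod xT < / 2 ->
  (forall x, 0 < x < 1 ->
     lam * Cmod xN * x - d < psi (x * (lam * Cmod xT + x / 2))) ->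
  Rbar_le (kobayashi (G_psi psi) (p_delta d) (xN, xT)) (/ lam).
Proof.
  intros Hpos Hmono Hlam Hd HN HT Hx.
  destruct (polar_form xN) as (u & Hu & EN).
  destruct (polar_form xT) as (v & Hv & ET).
  set (mu := lam * Cmod xN) in *. set (a := lam * Cmod xT) in *.
  assert (Hmu : 0 <= mu) by (apply Rmult_le_pos; [lra | apply Cmod_ge_0]).
  assert (Ha : 0 <= a) by (apply Rmult_le_pos; [lra | apply Cmod_ge_0]).
  assert (EN' : (RtoC lam * xN)%C = (RtoC mu * u)%C).
  { rewrite EN at 1. unfold mu. rewrite RtoC_mult. ring. }
  assert (ET' : (RtoC lam * xT)%C = (v * RtoC a)%C).
  { rewrite ET at 1. unfold a. rewrite RtoC_mult. ring. }
  assert (Dlin : forall p q z : C, cderiv (fun w => p + q * w)%C z q).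
  { intros p q z.
    pose proof (cderiv_plus (fun _ => p) (fun w => q * w)%C z 0 (q * 1)%C (cderiv_const p z)
      (cderiv_scale (fun w => w) q z 1 (cderiv_id _))) as H.
    replace (0 + q * 1)%C with q in H by ring. exact H. }
  (* The quadratic coefficient carries the phase u of xN, so Re (h w) = x / 2 with the same x that
     governs the first component. *)
  set (h := (RtoC (/ 2) * u)%C).
  apply (kobayashi_le psi d xN xT lam (fun w => RtoC (- d) + RtoC mu * u * w)%C
    (fun w => v * w * (RtoC a + h * w))%C Hlam).
  rewrite EN', ET'.
  assert (Dv : forall w, cderiv (fun w => v * w)%C w v).
  { intros w. pose proof (cderiv_scale (fun w => w) v w 1 (cderiv_id _)) as H.
    replace (v * 1)%C with v in H by ring. exact H. }
  split; [| split; [| split; [| split; [| split; [| split]]]]].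
  - intros w _. eexists. apply Dlin.
  - intros w _. eexists. apply cderiv_mult; [apply Dv | apply Dlin].
  - intros w Hw. pose proof (Cmod_ge_0 w) as Hw0.
    assert (Hh : Cmod h = / 2).
    { unfold h. rewrite Cmod_mult, Hu, Cmod_R, Rabs_pos_eq; lra. }
    assert (Hg1 : Cmod (v * w * (RtoC a + h * w)) < 1).
    { rewrite !Cmod_mult, Hv.
      pose proof (Cmod_triangle (RtoC a) (h * w)) as T.
      rewrite Cmod_mult, Hh, Cmod_R, Rabs_pos_eq in T by exact Ha.
      pose proof (Cmod_ge_0 (RtoC a + h * w)). nra. }
    split; [| split; [exact Hg1 |]].
    + eapply Rle_lt_trans; [apply Cmod_triangle |].
      rewrite !Cmod_mult, Hu, !Cmod_R, Rabs_Ropp, !Rabs_pos_eq by lra. nra.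
    + set (x := Re (u * w)%C).
      assert (Ef : Re (RtoC (- d) + RtoC mu * u * w)%C = mu * x - d).
      { rewrite re_plus, <- Cmult_assoc, re_scal_l, re_RtoC. fold x. ring. }
      rewrite Ef.
      assert (Hxw : Rabs x <= Cmod w).
      { unfold x. eapply Rle_trans; [apply re_le_Cmod |]. rewrite Cmod_mult, Hu. lra. }
      destruct (Rle_lt_dec x 0) as [L | L].
      * apply Rlt_le_trans with 0; [nra |].
        apply Hpos. split; [apply Cmod_ge_0 | lra].
      * rewrite Rabs_pos_eq in Hxw by lra.
        eapply Rlt_le_trans; [apply Hx; lra |].
        apply Hmono; [| | lra].
        { apply Rmult_le_pos; lra. }
        rewrite !Cmod_mult, Hv, Rmult_1_l.
        apply Rmult_le_compat; [lra | lra | exact Hxw |].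
        apply Rle_trans with (Re (RtoC a + h * w)%C).
        { unfold h. rewrite re_plus, <- Cmult_assoc, re_scal_l, re_RtoC. fold x. lra. }
        eapply Rle_trans; [apply Rle_abs | apply re_le_Cmod].
  - ring.
  - ring.
  - apply Dlin.
  - pose proof (cderiv_mult _ _ 0 _ _ (Dv 0) (Dlin (RtoC a) h 0)) as H.
    cbv beta in H.
    replace (v * (RtoC a + h * 0) + v * 0 * h)%C with (v * RtoC a)%C in H by ring.
    exact H.
Qed.

(** The zero vector is set apart because the later choices of [lam] divide by the size of the
    vector. Every [lam] is admissible here, so the infimum is below every positive number. *)
Lemma kobayashi_zero (psi : R -> R) (d : R) :
  (forall x, 0 <= x <= 1 -> 0 <= psi x) -> nondecr psi -> 0 < d < 1 ->
  Rbar_le (kobayashi (G_psi psi) (p_delta d) (RtoC 0, RtoC 0)) 0.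
Proof.
  intros Hpos Hmono Hd.
  assert (H : forall e, 0 < e -> Rbar_le (kobayashi (G_psi psi) (p_delta d) (RtoC 0, RtoC 0)) e).
  { intros e He. rewrite <- (Rinv_inv e).
    apply kobayashi_upper; rewrite ?Cmod_0, ?Rmult_0_r; try assumption; try lra.
    - apply Rinv_0_lt_compat, He.
    - intros x Hx. rewrite Rmult_0_l. apply Rlt_le_trans with 0; [lra |].
      apply Hpos. nra. }
  destruct (kobayashi _ _ _) as [k | |]; simpl in *.
  - apply le_epsilon. intros e He. rewrite Rplus_0_l. apply H, He.
  - exact (H 1 Rlt_0_1).
  - exact I.
Qed.

(** * Monotonicity of psi and its ratios up to the endpoint 1 *)

(** The ratio hypotheses stop short of 1, but the inverse functions may take the value 1. An
    inequality linear in psi y is passed to the left limit; the free sign of [k] serves both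
    increasing and decreasing ratios. *)
Lemma le_at_1 (psi u : R -> R) (k x : R) :
  standing psi -> continuous u 1 -> x < 1 ->
  (forall y, x < y < 1 -> psi y * k <= u y) -> psi 1 * k <= u 1.
Proof.
  intros (_ & Hc & _) Hu Hx H.
  specialize (Hc 1 ltac:(lra)).
  assert (Hpsi : filterlim psi (at_left 1) (locally (psi 1))).
  { eapply filterlim_filter_le_1; [| exact Hc].
    intros P [e He]. exists (mkposreal _ (Rmin_glb_lt _ _ _ (cond_pos e) Rlt_0_1)).
    intros y By Hy. apply He.
    - eapply ball_le; [apply Rmin_l | exact By].
    - apply (ball_le _ _ _ (Rmin_r e 1)) in By. apply Rabs_lt_between in By.
      unfold minus, plus, opp in By; simpl in By. lra. }
  assert (A : Rbar_le (psi 1 * k) (u 1)); [| exact A].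
  apply (filterlim_le (F := at_left 1) (fun y => psi y * k) u).
  - exists (mkposreal (1 - x) ltac:(lra)). intros y By Hy.
    apply Rabs_lt_between in By. unfold minus, plus, opp in By; simpl in By.
    apply H. lra.
  - apply (filterlim_comp _ _ _ psi (fun z => z * k) _ _ _ Hpsi).
    apply (ex_derive_continuousR (fun z => z * k)). auto_derive. exact I.
  - apply (filterlim_filter_le_1 u) with (2 := Hu). apply filter_le_within.
Qed.

Lemma Rdiv_le_cross (a b p q : R) : 0 < p -> 0 < q -> a / p <= b / q <-> a * q <= b * p.
Proof.
  intros Hp Hq.
  assert (E : b / q * p = b * p / q) by (field; lra).
  rewrite Rle_div_l, E, <- Rle_div_r by assumption. reflexivity.
Qed.

Lemma ratio_incr_closed (psi w : R -> R) :
  standing psi -> continuous w 1 -> (forall x, 0 < x -> 0 < w x) ->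
  (forall x y, 0 < x /\ x <= y /\ y < 1 -> psi x / w x <= psi y / w y) ->
  forall x y, 0 < x -> x <= y -> y <= 1 -> psi x / w x <= psi y / w y.
Proof.
  intros Hs Hw Hpos H x y Hx Hxy Hy.
  destruct (Rlt_le_dec y 1) as [L | L]; [apply H; lra |].
  assert (y = 1) by lra. subst y.
  destruct (Rlt_le_dec x 1) as [L1 | L1]; [| replace x with 1 by lra; lra].
  pose proof (Hpos x Hx). pose proof (Hpos 1 ltac:(lra)).
  assert (K : psi 1 * - w x <= - psi x * w 1).
  { apply (le_at_1 psi (fun y => - psi x * w y) (- w x) x Hs).
    - apply (continuous_mult (fun _ => - psi x) w); [apply continuous_const | exact Hw].
    - exact L1.
    - intros y Hy'. pose proof (H x y ltac:(lra)) as E.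
      pose proof (Hpos y ltac:(lra)).
      apply (Rdiv_le_cross _ _ (w x) (w y)) in E; lra. }
  apply Rdiv_le_cross; lra.
Qed.

Lemma ratio_decr_closed (psi : R -> R) :
  standing psi ->
  (forall x y, 0 < x /\ x <= y /\ y < 1 -> psi y / y <= psi x / x) ->
  forall x y, 0 < x -> x <= y -> y <= 1 -> psi y / y <= psi x / x.
Proof.
  intros Hs H x y Hx Hxy Hy.
  destruct (Rlt_le_dec y 1) as [L | L]; [apply H; lra |].
  assert (y = 1) by lra. subst y.
  destruct (Rlt_le_dec x 1) as [L1 | L1]; [| replace x with 1 by lra; lra].
  assert (K : psi 1 * x <= psi x * 1).
  { apply (le_at_1 psi (fun y => psi x * y) x x Hs).
    - apply (ex_derive_continuousR (fun y => psi x * y)). auto_derive. exact I.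
    - exact L1.
    - intros y Hy'. pose proof (H x y ltac:(lra)) as E.
      apply (Rdiv_le_cross _ _ y x) in E; lra. }
  apply Rdiv_le_cross; lra.
Qed.

Definition sqrt_incr (psi : R -> R) : Prop :=
  forall x y, 0 < x -> x <= y -> y <= 1 -> psi x / sqrt x <= psi y / sqrt y.

(** psi(x) / sqrt x is the product of the nonnegative nondecreasing functions psi(x) / x and sqrt
    x. *)
Lemma sqrt_incr_of_ratio (psi : R -> R) :
  standing psi ->
  (forall x y, 0 < x -> x <= y -> y <= 1 -> psi x / x <= psi y / y) -> sqrt_incr psi.
Proof.
  intros (Hpos & _) H x y Hx Hxy Hy.
  pose proof (sqrt_lt_R0 x Hx). pose proof (sqrt_lt_R0 y ltac:(lra)).
  assert (E : forall z, 0 < z -> psi z / sqrt z = psi z / z * sqrt z).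
  { intros z Hz. pose proof (sqrt_lt_R0 z Hz). pose proof (sqrt_sqrt z ltac:(lra)) as S2.
    set (r := sqrt z) in *. rewrite <- S2. field. lra. }
  rewrite !E by lra.
  apply Rmult_le_compat; [| lra | apply H; lra | apply sqrt_le_1_alt; lra].
  apply Rle_div_r; [lra |]. rewrite Rmult_0_l. apply Hpos. lra.
Qed.

Lemma sqrt_incr_nondecr (psi : R -> R) : standing psi -> sqrt_incr psi -> nondecr psi.
Proof.
  intros (Hpos & _ & H0 & _) H x y Hx Hxy Hy.
  destruct (Req_dec x 0) as [-> | Hx0].
  { rewrite H0. apply Hpos. lra. }
  pose proof (sqrt_lt_R0 x ltac:(lra)) as Sx. pose proof (sqrt_lt_R0 y ltac:(lra)) as Sy.
  pose proof (H x y ltac:(lra) Hxy Hy) as E.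
  apply (Rdiv_le_cross _ _ (sqrt x) (sqrt y)) in E; [| exact Sx | exact Sy].
  apply Rmult_le_reg_r with (sqrt y); [exact Sy |].
  eapply Rle_trans; [exact E |].
  apply Rmult_le_compat_l; [apply Hpos; lra | apply sqrt_le_1_alt; lra].
Qed.

Lemma sqrt_incr_lower (psi : R -> R) (s x : R) : standing psi -> sqrt_incr psi ->
  0 < s -> s <= x * x / 2 -> 0 < x < 1 ->
  psi s / sqrt s * x / sqrt 2 <= psi (x * x / 2).
Proof.
  intros Hst H Hs Hsx Hx.
  pose proof (H s (x * x / 2) Hs Hsx ltac:(nra)) as E.
  assert (Hxx : sqrt (x * x / 2) = x / sqrt 2).
  { rewrite sqrt_div_alt, sqrt_square by lra. reflexivity. }
  rewrite Hxx in E.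
  pose proof (sqrt_lt_R0 2 ltac:(lra)) as S2.
  assert (0 < x / sqrt 2) by (apply Rdiv_lt_0_compat; lra).
  apply Rle_div_r in E; [| assumption].
  eapply Rle_trans; [| exact E]. unfold Rdiv. lra.
Qed.

(** * Choice of the discs in the two regimes *)

(** The range where the quadratic term suffices: psi(x^2 / 2) >= (psi s / sqrt s) x / sqrt 2, and
    the slope constant c <= 1/2 is below 1 / sqrt 2. Strictness comes from d > 0. *)
Lemma disc_far (psi : R -> R) (s c x a d : R) : standing psi -> sqrt_incr psi ->
  0 < s -> 0 < c <= / 2 -> 0 < d -> 0 <= a -> 0 < x < 1 -> a + x / 2 <= 1 -> s <= x * x / 2 ->
  c * (psi s / sqrt s) * x - d < psi (x * (a + x / 2)).
Proof.
  intros Hst H Hs Hc Hd Ha Hx Hax Hsx.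
  apply Rlt_le_trans with (psi (x * x / 2)).
  2:{ apply (sqrt_incr_nondecr psi Hst H); nra. }
  eapply Rlt_le_trans; [| apply (sqrt_incr_lower psi s x Hst H Hs Hsx Hx)].
  assert (Hp : 0 <= psi s / sqrt s).
  { apply Rle_div_r; [apply sqrt_lt_R0; exact Hs |]. rewrite Rmult_0_l.
    apply (proj1 Hst). nra. }
  pose proof (sqrt_lt_R0 2 ltac:(lra)) as S2. pose proof (sqrt_sqrt 2 ltac:(lra)) as S22.
  assert (c * sqrt 2 <= 1) by nra.
  apply Rlt_le_trans with (c * (psi s / sqrt s) * x); [lra |].
  apply (Rle_div_r _ _ (sqrt 2)); [exact S2 |].
  assert (0 <= psi s / sqrt s * x) by (apply Rmult_le_pos; lra). nra.
Qed.

(** [lam] is fixed by mu = c d / sqrt s. As long as mu x < d the real part is negative; from there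
    on x >= sqrt s / c >= 2 sqrt s, which lies in the range of [disc_far]. *)
Lemma upper_normal (psi : R -> R) (d d0 c s : R) (xN xT : C) :
  standing psi -> sqrt_incr psi -> 0 < d <= d0 -> 0 < c <= / 2 -> d0 + c * psi 1 < 1 ->
  0 < s <= 1 -> psi s = d -> 8 * d * Cmod xT <= s * Cmod xN ->
  Rbar_le (kobayashi (G_psi psi) (p_delta d) (xN, xT)) (/ c * (sqrt s / d) * Cmod xN).
Proof.
  intros Hst H Hd Hc Hd0 Hs Hps Ht.
  pose proof (Cmod_ge_0 xN) as HN0. pose proof (Cmod_ge_0 xT) as HT0.
  pose proof (sqrt_incr_nondecr psi Hst H) as Hmono.
  destruct (Req_dec (Cmod xN) 0) as [EN | EN].
  { assert (ET : Cmod xT = 0) by nra.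
    rewrite (Cmod_eq_0 _ EN), (Cmod_eq_0 _ ET), Cmod_0, Rmult_0_r.
    assert (0 < psi 1) by apply Hst.
    apply kobayashi_zero; [apply Hst | exact Hmono | nra]. }
  pose proof (sqrt_lt_R0 s ltac:(lra)) as Ss. pose proof (sqrt_sqrt s ltac:(lra)) as Sss.
  set (nu := d / sqrt s).
  assert (Hnu : 0 < nu) by (apply Rdiv_lt_0_compat; lra).
  assert (Hnu1 : nu <= psi 1).
  (* Comparing psi / sqrt at s and at 1 bounds mu by c psi(1) uniformly in d, which keeps the first
     component in the unit disc. *)
  { pose proof (H s 1 ltac:(lra) ltac:(lra) ltac:(lra)) as E.
    rewrite Hps, sqrt_1 in E. unfold nu, Rdiv in *. lra. }
  set (lam := c * nu / Cmod xN).
  assert (Hlam : 0 < lam).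
  { apply Rdiv_lt_0_compat; [apply Rmult_lt_0_compat; lra | lra]. }
  replace (/ c * (sqrt s / d) * Cmod xN) with (/ lam)
    by (unfold lam, nu; field; repeat split; lra).
  assert (Emu : lam * Cmod xN = c * nu) by (unfold lam; field; lra).
  assert (Ha : lam * Cmod xT <= c * sqrt s / 8).
  { apply Rmult_le_reg_l with (8 * d); [lra |].
    replace (8 * d * (lam * Cmod xT)) with (lam * (8 * d * Cmod xT)) by ring.
    apply Rle_trans with (lam * (s * Cmod xN)); [apply Rmult_le_compat_l; lra |].
    replace (lam * (s * Cmod xN)) with (s * (lam * Cmod xN)) by ring.
    rewrite Emu. unfold nu. rewrite <- Sss at 1. apply Req_le. field. lra. }
  assert (Hs1 : sqrt s <= 1) by nra.
  assert (Ha0 : 0 <= lam * Cmod xT) by (apply Rmult_le_pos; lra).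
  apply kobayashi_upper; [apply Hst | exact Hmono | exact Hlam | lra | | nra |].
  - rewrite Emu. nra.
  - intros x Hx. rewrite Emu.
    destruct (Rlt_le_dec (c * nu * x) d) as [L | L].
    + apply Rlt_le_trans with 0; [lra |]. apply (proj1 Hst). nra.
    + unfold nu. rewrite <- Hps at 1.
      apply disc_far; try assumption; try lra.
      * nra.
      * assert (Hxs : sqrt s <= c * x).
        { apply Rmult_le_reg_l with nu; [exact Hnu |].
          replace (nu * sqrt s) with d by (unfold nu; field; lra). lra. }
        assert (2 * sqrt s <= x) by nra. nra.
Qed.

(* Three halvings gain the factor [8] that separates [psi1 s] from [1 / t]. *)
Lemma halving_eight (psi : R -> R) (K s : R) : 1 < K -> 0 < s <= 1 ->
  (forall x, 0 < x <= / K -> psi (K * x) / (K * x) <= / 2 * (psi x / x)) ->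
  8 * (psi s / s) <= psi (s / K ^ 3) / (s / K ^ 3).
Proof.
  intros HK Hs H.
  assert (HKi : 0 < / K < 1).
  { split; [apply Rinv_0_lt_compat; lra |]. rewrite <- Rinv_1. apply Rinv_lt_contravar; lra. }
  assert (Hstep : forall y, 0 < y <= 1 -> 0 < y / K <= / K /\
     2 * (psi y / y) <= psi (y / K) / (y / K)).
  { intros y Hy. assert (Hy' : 0 < y / K <= / K).
    { split; [apply Rdiv_lt_0_compat; lra |]. unfold Rdiv. nra. }
    split; [exact Hy' |].
    pose proof (H _ Hy') as E. replace (K * (y / K)) with y in E by (field; lra). lra. }
  destruct (Hstep s Hs) as [H1 E1].
  destruct (Hstep (s / K)) as [H2 E2]; [lra |].
  destruct (Hstep (s / K / K)) as [H3 E3]; [lra |].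
  replace (s / K ^ 3) with (s / K / K / K) by (field; lra). lra.
Qed.

(** Here d may be far below psi s, so a negative real part no longer covers the small x. The linear
    term a x takes over: the assumed equality gives a = c sqrt s / 8 exactly, and the halving
    property makes psi(a x) large enough. *)
Lemma upper_tangential (psi : R -> R) (d d0 c K s : R) (xN xT : C) :
  standing psi -> sqrt_incr psi ->
  (forall x y, 0 < x -> x <= y -> y <= 1 -> psi y / y <= psi x / x) ->
  1 < K -> (forall x, 0 < x <= / K -> psi (K * x) / (K * x) <= / 2 * (psi x / x)) ->
  0 < d <= d0 -> 0 < c <= / 2 -> d0 + c * psi 1 < 1 -> c * K ^ 3 <= 5 ->
  0 < s <= 1 -> 0 < psi s -> xN <> 0 -> 8 * psi s * Cmod xT = s * Cmod xN ->
  Rbar_le (kobayashi (G_psi psi) (p_delta d) (xN, xT)) (/ c * (sqrt s / psi s) * Cmod xN).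
Proof.
  intros Hst H Hdecr HK Hhalf Hd Hc Hd0 HcK Hs Hps HxN Ht.
  apply Cmod_gt_0 in HxN. pose proof (Cmod_ge_0 xT) as HT0.
  pose proof (sqrt_incr_nondecr psi Hst H) as Hmono.
  pose proof (sqrt_lt_R0 s ltac:(lra)) as Ss. pose proof (sqrt_sqrt s ltac:(lra)) as Sss.
  set (nu := psi s / sqrt s).
  assert (Hnu : 0 < nu) by (apply Rdiv_lt_0_compat; lra).
  assert (Hnu1 : nu <= psi 1).
  { pose proof (H s 1 ltac:(lra) ltac:(lra) ltac:(lra)) as E.
    rewrite sqrt_1 in E. unfold nu, Rdiv in *. lra. }
  set (lam := c * nu / Cmod xN).
  assert (Hlam : 0 < lam).
  { apply Rdiv_lt_0_compat; [apply Rmult_lt_0_compat; lra | lra]. }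
  replace (/ c * (sqrt s / psi s) * Cmod xN) with (/ lam)
    by (unfold lam, nu; field; repeat split; lra).
  assert (Emu : lam * Cmod xN = c * nu) by (unfold lam; field; lra).
  assert (Ea : lam * Cmod xT = c * sqrt s / 8).
  { apply Rmult_eq_reg_l with (8 * psi s); [| lra].
    replace (8 * psi s * (lam * Cmod xT)) with (lam * (8 * psi s * Cmod xT)) by ring.
    rewrite Ht. replace (lam * (s * Cmod xN)) with (s * (lam * Cmod xN)) by ring.
    rewrite Emu. unfold nu. rewrite <- Sss at 1. field. lra. }
  assert (Hs1 : sqrt s <= 1) by nra.
  apply kobayashi_upper; [apply Hst | exact Hmono | exact Hlam | lra | | nra |].
  - rewrite Emu. nra.
  - intros x Hx. rewrite Emu, Ea.
    assert (HK3 : 0 < K ^ 3) by (apply pow_lt; lra).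
    set (a := c * sqrt s / 8).
    assert (Ha : 0 < a) by (unfold a; nra).
    assert (Ha1 : a < / 2) by (unfold a; nra).
    assert (Hax : 0 < a * x) by (apply Rmult_lt_0_compat; lra).
    (* mu x = 8 (psi s / s) a x. Below s / K^3 the decreasing ratio psi(y) / y is at least 8 psi s /
       s, so psi(a x) >= mu x. *)
    destruct (Rle_lt_dec (a * x) (s / K ^ 3)) as [L | L].
    + apply Rlt_le_trans with (psi (a * x)).
      2:{ apply Hmono; nra. }
      pose proof (halving_eight psi K s HK Hs Hhalf) as E8.
      pose proof (Hdecr (a * x) (s / K ^ 3) Hax L) as E1.
      assert (Hle : s / K ^ 3 <= 1).
      { apply Rle_div_l; [exact HK3 |]. assert (1 <= K ^ 3) by (apply pow_R1_Rle; lra). lra. }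
      specialize (E1 Hle).
      assert (E : 8 * (psi s / s) <= psi (a * x) / (a * x)) by lra.
      apply Rle_div_r in E; [| exact Hax].
      replace (8 * (psi s / s) * (a * x)) with (c * nu * x) in E.
      2:{ assert (E' : psi s / s = nu / sqrt s).
          { unfold nu. rewrite <- Sss at 2. field. lra. }
          rewrite E'. unfold a. field. lra. }
      lra.
    + apply disc_far; try assumption; try lra.
      assert (HsK : s < a * x * K ^ 3) by (apply (Rlt_div_l s (a * x) (K ^ 3)) in L; lra).
      (* The origin of c K^3 <= 5: it gives s < (25/64) x^2, below the x^2 / 2 that [disc_far] asks
         for. *)
      assert (Hsx : 8 * sqrt s < 5 * x).
      { assert (A : sqrt s * (8 * sqrt s) < sqrt s * (c * K ^ 3 * x)).
        { replace (sqrt s * (c * K ^ 3 * x)) with (8 * (a * x * K ^ 3)) by (unfold a; field).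
          lra. }
        apply Rmult_lt_reg_l in A; [| exact Ss]. nra. }
      nra.
Qed.

(** * The estimates *)

(** The three demands on c: the slope in [disc_far], the first component staying in the unit disc (p
    = psi 1), and the far range of [upper_tangential] (b = K^3). *)
Lemma small_const (p d0 b : R) : 0 < p -> 0 < d0 < 1 -> 0 < b ->
  exists c, 0 < c <= / 2 /\ d0 + c * p < 1 /\ c * b <= 5.
Proof.
  intros Hp Hd0 Hb.
  set (e := (1 - d0) / (2 * (p + 1))).
  assert (He : 0 < e) by (apply Rdiv_lt_0_compat; lra).
  assert (Ee : e * (p + 1) = (1 - d0) / 2) by (unfold e; field; lra).
  assert (Hb5 : 0 < 5 / b) by (apply Rdiv_lt_0_compat; lra).
  assert (E5 : 5 / b * b = 5) by (field; lra).
  set (m := Rmin e (5 / b)).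
  assert (Hm : 0 < m) by (apply Rmin_glb_lt; assumption).
  exists (Rmin (/ 2) m).
  assert (Hc : 0 < Rmin (/ 2) m) by (apply Rmin_glb_lt; lra).
  pose proof (Rmin_l (/ 2) m). pose proof (Rmin_r (/ 2) m).
  pose proof (Rmin_l e (5 / b)) as M1. pose proof (Rmin_r e (5 / b)) as M2. fold m in M1, M2.
  split; [lra | split]; nra.
Qed.

Lemma psi_inverse_pos (psi : R -> R) (s d : R) :
  standing psi -> 0 < d -> 0 <= s <= 1 -> psi s = d -> 0 < s <= 1.
Proof.
  intros (_ & _ & H0 & _) Hd Hs E.
  destruct (Req_dec s 0) as [-> | Hs0]; lra.
Qed.

(** For sg = psi_1^{-1}(1 / (8t)) one has 8t = sg / psi(sg), so both entries of F_3 are values of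
    the nonincreasing function sqrt x / psi x, at s and at sg, and the minimum sits at the larger
    argument. *)
Lemma estimate_between_sqrt_and_id (psi : R -> R) (d0 : R) (psiinv psi1inv : R -> R) :
  standing psi -> 0 < d0 < 1 ->
  (forall x y, 0 < x /\ x <= y /\ y < 1 -> psi x / sqrt x <= psi y / sqrt y) ->
  (forall x y, 0 < x /\ x <= y /\ y < 1 -> psi y / y <= psi x / x) ->
  (exists K, 1 < K /\ forall x, 0 < x <= / K -> psi (K * x) / (K * x) <= / 2 * (psi x / x)) ->
  (forall d, 0 < d <= d0 -> 0 <= psiinv d <= 1 /\ psi (psiinv d) = d) ->
  (forall y, / 8 <= y -> 0 < psi1inv y <= 1 /\ psi (psi1inv y) / psi1inv y = y) ->
  exists c Cst : R, 0 < c < Cst /\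
    forall (d : R) (xN xT : C), 0 < d <= d0 -> xN <> RtoC 0 -> Cmod xT <= Cmod xN ->
      Rbar_le (c * F3 psiinv psi1inv d (Cmod xT / Cmod xN) * Cmod xN)
              (kobayashi (G_psi psi) (p_delta d) (xN, xT)) /\
      Rbar_le (kobayashi (G_psi psi) (p_delta d) (xN, xT))
              (Cst * F3 psiinv psi1inv d (Cmod xT / Cmod xN) * Cmod xN).
Proof.
  intros Hst Hd0 Hsq Hdec (K & HK & Hhalf) Hinv Hinv1.
  assert (Hincr : sqrt_incr psi).
  { refine (ratio_incr_closed psi sqrt Hst _ sqrt_lt_R0 Hsq).
    apply ex_derive_continuousR. auto_derive. lra. }
  pose proof (ratio_decr_closed psi Hst Hdec) as Hdecr.
  pose proof (sqrt_incr_nondecr psi Hst Hincr) as Hmono.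
  destruct (small_const (psi 1) d0 (K ^ 3)) as (c & Hc & Hcd & HcK);
    [apply Hst | exact Hd0 | apply pow_lt; lra |].
  pose proof (sqrt_lt_R0 2 ltac:(lra)) as S2. pose proof (sqrt_sqrt 2 ltac:(lra)) as S22.
  exists (/ (4 * sqrt 2)), (/ c). split.
  { split; [apply Rinv_0_lt_compat; lra | apply Rinv_lt_contravar; nra]. }
  intros d xN xT Hd HN HT. unfold F3.
  destruct (Hinv d Hd) as [Hs0 Hps].
  pose proof (psi_inverse_pos psi _ d Hst ltac:(lra) Hs0 Hps) as Hs.
  set (s := psiinv d) in *. clearbody s.
  assert (HN' : 0 < Cmod xN) by (apply Cmod_gt_0, HN).
  pose proof (Cmod_ge_0 xT) as HT0.
  (* The normal regime, used both for t = 0 and for sg <= s; in the latter case its hypothesis is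
     psi_1(s) <= psi_1(sg) = 1 / (8t). *)
  assert (HA : 8 * d * Cmod xT <= s * Cmod xN ->
    Rbar_le (/ (4 * sqrt 2) * (sqrt s / d) * Cmod xN) (kobayashi (G_psi psi) (p_delta d) (xN, xT)) /\
    Rbar_le (kobayashi (G_psi psi) (p_delta d) (xN, xT)) (/ c * (sqrt s / d) * Cmod xN)).
  { intros Ht. split.
    - rewrite <- Hps at 1. apply kobayashi_lower; rewrite ?Hps; (assumption || lra).
    - apply (upper_normal psi d d0); assumption. }
  destruct (Req_EM_T (Cmod xT / Cmod xN) 0) as [E | E].
  - apply HA. assert (Cmod xT = 0).
    { replace (Cmod xT) with (Cmod xT / Cmod xN * Cmod xN) by (field; lra). rewrite E. ring. }
    nra.
  - set (t := Cmod xT / Cmod xN) in *.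
    assert (Et : Cmod xT = t * Cmod xN) by (unfold t; field; lra).
    assert (Ht : 0 < t <= 1).
    { split; [| apply Rle_div_l; lra].
      assert (0 <= t) by (apply Rle_div_r; lra). lra. }
    destruct (Hinv1 (/ (8 * t))) as [Hsig Hpsig]; [apply Rinv_le_contravar; lra |].
    set (sg := psi1inv (/ (8 * t))) in *. clearbody sg.
    pose proof (sqrt_lt_R0 s ltac:(lra)) as Ss.
    pose proof (sqrt_lt_R0 sg ltac:(lra)) as Ssg. pose proof (sqrt_sqrt sg ltac:(lra)) as Ssgs.
    assert (Epsig : 8 * t * psi sg = sg).
    { replace (psi sg) with (psi sg / sg * sg) by (field; lra). rewrite Hpsig. field. lra. }
    assert (Hpsg : 0 < psi sg) by nra.
    assert (EB : 8 * t / sqrt sg = sqrt sg / psi sg).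
    { replace (8 * t) with (sqrt sg * sqrt sg / psi sg).
      - field. lra.
      - rewrite Ssgs. rewrite <- Epsig at 1. field. lra. }
    rewrite EB.
    assert (Ht8 : 8 * psi sg * Cmod xT = sg * Cmod xN).
    { rewrite Et. transitivity (8 * t * psi sg * Cmod xN); [ring | rewrite Epsig; reflexivity]. }
    destruct (Rle_lt_dec sg s) as [L | L].
    + rewrite Rmin_left.
      * apply HA.
        pose proof (Hdecr sg s ltac:(lra) L ltac:(lra)) as D. rewrite Hps in D.
        apply (Rdiv_le_cross _ _ s sg) in D; [| lra | lra].
        apply Rmult_le_reg_l with sg; [lra |].
        apply Rle_trans with (8 * Cmod xT * (psi sg * s)); [nra |].
        apply Req_le. replace (8 * Cmod xT * (psi sg * s)) with (8 * psi sg * Cmod xT * s) by ring.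
        rewrite Ht8. ring.
      * pose proof (Hincr sg s ltac:(lra) L ltac:(lra)) as D. rewrite Hps in D.
        apply (Rdiv_le_cross _ _ (sqrt sg) (sqrt s)) in D; [| lra | lra].
        apply Rdiv_le_cross; lra.
    + rewrite Rmin_right.
      * split.
        -- apply kobayashi_lower; [exact Hmono | lra | lra | | lra].
           rewrite <- Hps. apply Hmono; lra.
        -- apply (upper_tangential psi d d0 c K); assumption.
      * pose proof (Hincr s sg ltac:(lra) ltac:(lra) ltac:(lra)) as D. rewrite Hps in D.
        apply (Rdiv_le_cross _ _ (sqrt s) (sqrt sg)) in D; [| lra | lra].
        apply Rdiv_le_cross; lra.
Qed.

(** With p = sqrt d and M the maximum in the statement, lam = c / M gives a <= c and mu <= a + c p.
    The a x terms then cancel and c p x is absorbed by p^2 + x^2 / 2. The 3 in c comes from d + mu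
    <= d0 + 2 c < 1. *)
Lemma estimate_id (d0 : R) : 0 < d0 < 1 ->
  exists c Cst : R, 0 < c < Cst /\
    forall (d : R) (xN xT : C), 0 < d <= d0 ->
      Rbar_le (c * Rmax ((Cmod xN - Cmod xT) / sqrt d) (Cmod xT))
              (kobayashi (G_psi (fun x => x)) (p_delta d) (xN, xT)) /\
      Rbar_le (kobayashi (G_psi (fun x => x)) (p_delta d) (xN, xT))
              (Cst * Rmax ((Cmod xN - Cmod xT) / sqrt d) (Cmod xT)).
Proof.
  intros Hd0.
  set (c := (1 - d0) / 3).
  assert (Hc : 0 < c < / 3) by (unfold c; lra).
  exists (/ 5), (/ c). split.
  { split; [lra |]. apply Rinv_lt_contravar; nra. }
  intros d xN xT Hd. split; [apply kobayashi_lower_id; lra |].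
  assert (Hpos : forall x : R, 0 <= x <= 1 -> 0 <= x) by (intros; lra).
  assert (Hmono : nondecr (fun x => x)) by (intros x y; lra).
  pose proof (sqrt_lt_R0 d ltac:(lra)) as Sd. pose proof (sqrt_sqrt d ltac:(lra)) as Sdd.
  set (p := sqrt d) in *.
  pose proof (Cmod_ge_0 xN) as HN0. pose proof (Cmod_ge_0 xT) as HT0.
  pose proof (Rmax_l ((Cmod xN - Cmod xT) / p) (Cmod xT)) as M1.
  pose proof (Rmax_r ((Cmod xN - Cmod xT) / p) (Cmod xT)) as M2.
  set (M := Rmax ((Cmod xN - Cmod xT) / p) (Cmod xT)) in *.
  apply (Rle_div_l _ _ p) in M1; [| exact Sd].
  destruct (Req_dec M 0) as [EM | EM].
  { rewrite EM in *.
    rewrite (Cmod_eq_0 xN), (Cmod_eq_0 xT), Rmult_0_r by lra.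
    apply kobayashi_zero; [exact Hpos | exact Hmono | lra]. }
  set (lam := c / M).
  assert (Hlam : 0 < lam) by (apply Rdiv_lt_0_compat; lra).
  assert (ElM : lam * M = c) by (unfold lam; field; exact EM).
  replace (/ c * M) with (/ lam) by (unfold lam; field; lra).
  assert (Ha : lam * Cmod xT <= c) by (rewrite <- ElM; apply Rmult_le_compat_l; lra).
  assert (Ha0 : 0 <= lam * Cmod xT) by (apply Rmult_le_pos; lra).
  assert (Hmu : lam * Cmod xN <= lam * Cmod xT + c * p).
  { rewrite <- ElM. replace (lam * Cmod xT + lam * M * p) with (lam * (Cmod xT + M * p)) by ring.
    apply Rmult_le_compat_l; lra. }
  assert (Hp1 : p < 1) by nra.
  apply kobayashi_upper; [exact Hpos | exact Hmono | exact Hlam | lra | | lra |].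
  - assert (c * p <= c) by nra. unfold c in *. lra.
  - intros x Hx.
    set (a := lam * Cmod xT) in *. set (mu := lam * Cmod xN) in *.
    assert (mu * x <= (a + c * p) * x) by (apply Rmult_le_compat_r; lra).
    assert (c * p * x <= / 3 * (p * x)).
    { rewrite Rmult_assoc. apply Rmult_le_compat_r; [nra | lra]. }
    nra.
Qed.

(** The assumed range of xT is the hypothesis of [kobayashi_lower] and [upper_normal] at s =
    psi^{-1}(d), so only the normal regime occurs. *)
Lemma estimate_superlinear (psi : R -> R) (d0 : R) (psiinv : R -> R) :
  standing psi -> 0 < d0 < 1 ->
  (forall x y, 0 < x /\ x <= y /\ y < 1 -> psi x / x <= psi y / y) ->
  (forall d, 0 < d < psi 1 -> d <= d0 -> 0 <= psiinv d <= 1 /\ psi (psiinv d) = d) ->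
  exists Cst : R, 0 < Cst /\
    forall (d : R) (xN xT : C), 0 < d < psi 1 -> d <= d0 ->
      Cmod xT <= psiinv d / (8 * d) * Cmod xN ->
      Rbar_le (/ (4 * sqrt 2) * (sqrt (psiinv d) / d) * Cmod xN)
              (kobayashi (G_psi psi) (p_delta d) (xN, xT)) /\
      Rbar_le (kobayashi (G_psi psi) (p_delta d) (xN, xT))
              (Cst * (sqrt (psiinv d) / d) * Cmod xN).
Proof.
  intros Hst Hd0 Hr Hinv.
  assert (Hincr : sqrt_incr psi).
  { apply (sqrt_incr_of_ratio psi Hst).
    exact (ratio_incr_closed psi (fun x => x) Hst (continuous_id _) (fun x Hx => Hx) Hr). }
  pose proof (sqrt_incr_nondecr psi Hst Hincr) as Hmono.
  destruct (small_const (psi 1) d0 1) as (c & Hc & Hcd & _); [apply Hst | exact Hd0 | lra |].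
  exists (/ c). split; [apply Rinv_0_lt_compat; lra |].
  intros d xN xT Hd Hdd HT.
  destruct (Hinv d Hd Hdd) as [Hs0 Hps].
  pose proof (psi_inverse_pos psi _ d Hst ltac:(lra) Hs0 Hps) as Hs.
  set (s := psiinv d) in *. clearbody s.
  assert (Ht : 8 * d * Cmod xT <= s * Cmod xN).
  { apply (Rmult_le_compat_l (8 * d)) in HT; [| lra].
    replace (8 * d * (s / (8 * d) * Cmod xN)) with (s * Cmod xN) in HT by (field; lra). exact HT. }
  split.
  - rewrite <- Hps at 1. apply kobayashi_lower; rewrite ?Hps; (assumption || lra).
  - apply (upper_normal psi d d0); (assumption || lra).
Qed.

Theorem theorem4 :
  (* (1) *)
  (forall (psi : R -> R) (d0 : R) (psiinv psi1inv : R -> R),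
    standing psi -> 0 < d0 < 1 ->
    (forall x y, 0 < x /\ x <= y /\ y < 1 -> psi x / sqrt x <= psi y / sqrt y) ->
    (forall x y, 0 < x /\ x <= y /\ y < 1 -> psi y / y <= psi x / x) ->
    (exists K, 1 < K /\ forall x, 0 < x <= / K -> psi (K * x) / (K * x) <= / 2 * (psi x / x)) ->
    (* psi^{-1} and psi_1^{-1} are inverses at the arguments used *)
    (forall d, 0 < d <= d0 -> 0 <= psiinv d <= 1 /\ psi (psiinv d) = d) ->
    (forall y, / 8 <= y -> 0 < psi1inv y <= 1 /\ psi (psi1inv y) / psi1inv y = y) ->
    exists c Cst : R, 0 < c < Cst /\
      forall (d : R) (xN xT : C), 0 < d <= d0 -> xN <> RtoC 0 -> Cmod xT <= Cmod xN ->
        Rbar_le (c * F3 psiinv psi1inv d (Cmod xT / Cmod xN) * Cmod xN)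
                (kobayashi (G_psi psi) (p_delta d) (xN, xT)) /\
        Rbar_le (kobayashi (G_psi psi) (p_delta d) (xN, xT))
                (Cst * F3 psiinv psi1inv d (Cmod xT / Cmod xN) * Cmod xN))
  /\
  (* (2) psi(x) = x *)
  (forall d0 : R, 0 < d0 < 1 ->
    exists c Cst : R, 0 < c < Cst /\
      forall (d : R) (xN xT : C), 0 < d <= d0 ->
        Rbar_le (c * Rmax ((Cmod xN - Cmod xT) / sqrt d) (Cmod xT))
                (kobayashi (G_psi (fun x => x)) (p_delta d) (xN, xT)) /\
        Rbar_le (kobayashi (G_psi (fun x => x)) (p_delta d) (xN, xT))
                (Cst * Rmax ((Cmod xN - Cmod xT) / sqrt d) (Cmod xT)))
  /\
  (* (3) *)
  (forall (psi : R -> R) (d0 : R) (psiinv : R -> R),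
    standing psi -> 0 < d0 < 1 ->
    (forall x y, 0 < x /\ x <= y /\ y < 1 -> psi x / x <= psi y / y) ->
    (forall d, 0 < d < psi 1 -> d <= d0 -> 0 <= psiinv d <= 1 /\ psi (psiinv d) = d) ->
    exists Cst : R, 0 < Cst /\
      forall (d : R) (xN xT : C), 0 < d < psi 1 -> d <= d0 ->
        Cmod xT <= psiinv d / (8 * d) * Cmod xN ->
        Rbar_le (/ (4 * sqrt 2) * (sqrt (psiinv d) / d) * Cmod xN)
                (kobayashi (G_psi psi) (p_delta d) (xN, xT)) /\
        Rbar_le (kobayashi (G_psi psi) (p_delta d) (xN, xT))
                (Cst * (sqrt (psiinv d) / d) * Cmod xN)).
Proof.
  split; [exact estimate_between_sqrt_and_id | split; [exact estimate_id | exact estimate_superlinear]].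
Qed.
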